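(* Let $\{\boldsymbol{w},p\}$, $\boldsymbol{w}=(u,v)$, be a solution of the system $$\Delta \boldsymbol{w}-(\boldsymbol{w}\cdot\nabla)\boldsymbol{w}-(ay\partial_x+b\partial_y)\boldsymbol{w}-(av,0)=\nabla p,\qquad \nabla\cdot\boldsymbol{w}=0$$ in the upper half plane $\mathbb{R}^2_+$, with the boundary condition $v(x,0)=0$, $\partial_y u(x,0)=0$ for all $x\in\mathbb{R}$. Assume $\boldsymbol{w}\in C^{2}(\overline{\mathbb{R}^2_+})$ and $$\int_{\mathbb{R}^2_+}|\nabla\boldsymbol{w}|^{2}\,dx\,dy<\infty.$$ Then $\boldsymbol{w}$ and $p$ are constant in $\mathbb{R}^2_+$.
   Context: $a,b$ are fixed real constants. $\mathbb{R}^2_+=\{(x,y)\in\mathbb{R}^2: y>0\}$. $C^2(\overline{\mathbb{R}^2_+})$ means that all derivatives up to order 2 extend continuously to the closed half plane (no boundedness at infinity is assumed). *)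

(* Defs.v *)
From HB Require Import structures.
From mathcomp Require Import all_boot all_order all_algebra.
From mathcomp Require Import all_classical all_reals all_analysis.
Set Implicit Arguments.
Unset Strict Implicit.
Unset Printing Implicit Defensive.
Import Order.TTheory GRing.Theory Num.Theory.
Import numFieldNormedType.Exports.
Local Open Scope classical_set_scope.
Local Open Scope ring_scope.

Section HalfPlane.
Variable R : realType.
Implicit Types (f u v p : R * R -> R) (z : R * R).

Definition half_plane : set (R * R) := [set z | 0 < z.2].

Definition closed_half_plane : set (R * R) := [set z | 0 <= z.2].

(* ['D_e f z] is a junk value unless [derivable f z e]; derivability is
   assumed separately, in [Ck_closed] for u, v and in [is_solution] for p. *)
Definition dx f : R * R -> R := fun z => 'D_((1, 0) : R * R) f z.
Definition dy f : R * R -> R := fun z => 'D_((0, 1) : R * R) f z.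

Definition has_partials f : Prop :=
  forall z, half_plane z ->
    derivable f z ((1, 0) : R * R) /\ derivable f z ((0, 1) : R * R).

Definition extends_continuously f : Prop :=
  exists2 g : R * R -> R, {within closed_half_plane, continuous g}
                        & forall z, half_plane z -> g z = f z.

(* The class C^k of the closed half plane: only the values of f on the open
   half plane matter, the boundary values being those of the continuous
   extensions.  Nothing is assumed at infinity. *)
Fixpoint Ck_closed (k : nat) f : Prop :=
  if k is k'.+1 then
    [/\ extends_continuously f, has_partials f,
        Ck_closed k' (dx f) & Ck_closed k' (dy f)]
  else extends_continuously f.

(* The value at (x, 0) of the continuous extension of f is l. *)
Definition boundary_value f (x l : R) : Prop :=
  f z @[z --> within half_plane (nbhs ((x, 0) : R * R))] --> l.

Definition laplacian f : R * R -> R := fun z => dx (dx f) z + dy (dy f) z.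

(* ((c1, c2) . grad) f *)
Definition advect (c1 c2 : R * R -> R) f : R * R -> R :=
  fun z => c1 z * dx f z + c2 z * dy f z.

Definition is_solution (a b : R) u v p : Prop :=
  has_partials p /\
  forall z, half_plane z ->
    [/\ laplacian u z - advect u v u z
          - advect (fun t => a * t.2) (fun=> b) u z - a * v z = dx p z,
        laplacian v z - advect u v v z
          - advect (fun t => a * t.2) (fun=> b) v z = dy p z
      & dx u z + dy v z = 0].

Definition grad_sq u v : R * R -> R :=
  fun z => dx u z ^+ 2 + dy u z ^+ 2 + dx v z ^+ 2 + dy v z ^+ 2.

Definition dirichlet_integral u v : \bar R :=
  (\int[(@lebesgue_measure R) \x (@lebesgue_measure R)]_(z in half_plane)
     (grad_sq u v z)%:E)%E.

Definition constant_on_half_plane f : Prop :=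
  exists c : R, forall z, half_plane z -> f z = c.

End HalfPlane.

(* Main.v *)
(* With W = (u + a y, v + b) and total head P = p + |W|^2 / 2, the momentum
   equation expresses grad P by the rotated gradient of the vorticity
   w = v_x - u_y, by w times the rotated W, and by linear terms in a.  Let
   H(s) = sqrt(1 + s^2) - 1 and let eta be a cut-off function on the box
   [-r, r] x [dl, r].  Testing with H'(w) eta shows that the integral of
   H''(w) |grad w|^2 eta equals a boundary flux plus the integral of
   H(w) (lap eta + W . grad eta).  The flux vanishes as dl -> 0 because
   w = v = 0 on the boundary.  In the second integral W is not bounded, but w is
   square integrable, v and the deviation of u from its values on a vertical line
   are controlled by Hardy's inequality, and u grows at most linearly on some
   vertical line; hence it tends to 0 as r -> oo.  So grad w = 0, thus w = 0.
   The flow is then irrotational, and testing lap v = 0 with v eta gives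
   grad v = 0 in the same way. *)
Require Import Defs.
From HB Require Import structures.
From mathcomp Require Import all_boot all_order all_algebra.
From mathcomp Require Import all_classical all_reals all_analysis.
From mathcomp Require Import measurable_realfun ring lra.
Set Implicit Arguments.
Unset Strict Implicit.
Unset Printing Implicit Defensive.
Import Order.TTheory GRing.Theory Num.Theory.
Import numFieldNormedType.Exports.
Local Open Scope classical_set_scope.
Local Open Scope ring_scope.

(** * Integrals over a segment *)

Section Segment.
Variable R : realType.
Implicit Types (c d : R) (f g : R -> R).

(** Since [u] and [v] are only of class [C^2], the vorticity [w] is only [C^1], and its equation,
    which contains [lap w], has no classical meaning. It is used only in weak form: [grad P] is
    curl-free when tested against a function that vanishes on the sides of the box, which takes
    first derivatives of [P] alone. The gradient of the cut-off is of size [1/r] and Hardy's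
    inequality on the box costs [r^2], so the velocity contributes a term that stays bounded but is
    not small as [r] grows. Smallness comes from a parameter [k] of the arithmetic-geometric
    inequality, fixed before [r]: the velocity part is at most [k] times a constant depending on the
    Dirichlet integral alone, and the part with the large factor [4 / k] carries the weight
    [(1 + |x| + y) / r] against the Dirichlet density, hence vanishes by dominated convergence. The
    reference line for [u] is needed because [u], unlike [v], has no zero boundary value to start
    Hardy's inequality from. Linear growth along that line is harmless: the shear [a y] already
    grows at this rate. *)

Definition J c d f : R := \int[@lebesgue_measure R]_(x in `[c, d]) f x.

(** Two-sided continuity, end points included: the integrands are defined on a neighbourhood of the
    segment, and this form avoids subspace topologies. *)
Definition contI c d f := forall x, c <= x <= d -> {for x, continuous f}.

Lemma contI_within c d f : contI c d f -> {within `[c, d], continuous f}.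
Proof.
move=> cf; apply: continuous_in_subspaceT => x.
by rewrite inE /= in_itv /= => /cf.
Qed.

Lemma contI_integrable c d f : contI c d f ->
  (@lebesgue_measure R).-integrable `[c, d] (EFin \o f).
Proof.
move=> cf; apply: continuous_compact_integrable.
  exact: segment_compact.
exact: contI_within.
Qed.

Lemma contI_sub c d c' d' f :
  c <= c' -> d' <= d -> contI c d f -> contI c' d' f.
Proof. by move=> cc dd cf x /andP[xc xd]; apply: cf; lra. Qed.

Lemma J_eq c d f g : (forall x, c <= x <= d -> f x = g x) -> J c d f = J c d g.
Proof.
by move=> fg; apply: eq_Rintegral => x; rewrite inE /= in_itv /= => /fg.
Qed.

Lemma JD c d f g : contI c d f -> contI c d g ->
  J c d (fun x => f x + g x) = J c d f + J c d g.
Proof. by move=> /contI_integrable cf /contI_integrable cg; exact: RintegralD. Qed.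

Lemma JB c d f g : contI c d f -> contI c d g ->
  J c d (fun x => f x - g x) = J c d f - J c d g.
Proof. by move=> /contI_integrable cf /contI_integrable cg; exact: RintegralB. Qed.

Lemma JZ c d r f : contI c d f -> J c d (fun x => r * f x) = r * J c d f.
Proof. by move=> /contI_integrable cf; exact: RintegralZl. Qed.

Lemma J_le c d f g : contI c d f -> contI c d g ->
  (forall x, c <= x <= d -> f x <= g x) -> J c d f <= J c d g.
Proof.
move=> /contI_integrable cf /contI_integrable cg fg.
by apply: le_Rintegral => // x; rewrite /= in_itv /=; exact: fg.
Qed.

Lemma J_ge0 c d f : (forall x, c <= x <= d -> 0 <= f x) -> 0 <= J c d f.
Proof. by move=> f0; apply: Rintegral_ge0 => x; rewrite /= in_itv /=; exact: f0. Qed.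

Lemma J_cst c d r : c <= d -> J c d (fun=> r) = r * (d - c).
Proof.
move=> cd; rewrite /J Rintegral_cst//= lebesgue_measure_itv /= lte_fin.
by case: ltgtP cd => //= -> _; rewrite subrr mulr0.
Qed.

Lemma J_abs_le c d f M : c <= d -> contI c d f ->
  (forall x, c <= x <= d -> `|f x| <= M) -> `|J c d f| <= M * (d - c).
Proof.
move=> cd cf fM; rewrite -J_cst// ler_norml.
have cc r : contI c d (fun=> r) by move=> x _; exact: cvg_cst.
rewrite J_le ?andbT//; last by move=> x /fM; rewrite ler_norml => /andP[].
rewrite J_cst// -mulNr -J_cst//; apply: J_le => // x /fM.
by rewrite ler_norml => /andP[].
Qed.

Lemma J_sub c d c' d' f : contI c d f -> c <= c' -> d' <= d ->
  (forall x, c <= x <= d -> 0 <= f x) -> J c' d' f <= J c d f.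
Proof.
move=> cf cc dd f0; have cf' := contI_sub cc dd cf.
rewrite /J /Rintegral fine_le//.
- exact/integrable_fin_num/contI_integrable.
- exact/integrable_fin_num/contI_integrable.
- apply: ge0_subset_integral => //.
  + by apply: (measurable_int (@lebesgue_measure R)); exact: contI_integrable.
  + by move=> x /=; rewrite !in_itv /= => /andP[xc xd]; apply/andP; split; lra.
Qed.

Lemma J_split c d m f : c <= m <= d -> contI c d f ->
  J c d f = J c m f + J m d f.
Proof.
move=> /andP[cm md] cf.
have := @Rintegral_itvB R f (BLeft c) (BRight d) m (contI_integrable cf).
rewrite !bnd_simp => /(_ cm md); rewrite Rintegral_itv_obnd_cbnd.
  by rewrite /J => H; lra.
apply: integrableS (contI_integrable cf) => //= x /=.
by rewrite !in_itv /= => /andP[mx xd]; apply/andP; split; lra.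
Qed.

Lemma J_FTC c d (F f : R -> R) : c <= d -> contI c d f ->
  (forall x, c <= x <= d -> is_derive x 1 F (f x)) -> J c d f = F d - F c.
Proof.
rewrite le_eqVlt => /predU1P[<-|cd] cf dF.
  by rewrite subrr /J set_itv1 Rintegral_set1.
rewrite /J /Rintegral (@continuous_FTC2 _ f F)//.
- exact: contI_within.
- have cF x : c <= x <= d -> {for x, continuous F}.
    move=> /dF dFx; apply: differentiable_continuous.
    by apply/derivable1_diffP; apply: ex_derive.
  split.
  + move=> x; rewrite in_itv /= => /andP[cx xd].
    by have := dF x; rewrite !ltW// => /(_ isT) ?; exact: ex_derive.
  + by apply: cvg_at_right_filter; apply: cF; lra.
  + by apply: cvg_at_left_filter; apply: cF; lra.
- move=> x; rewrite in_itv /= => /andP[cx xd].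
  by have := dF x; rewrite !ltW// => /(_ isT) ?; rewrite derive1E derive_val.
Qed.
End Segment.

(** * Differentiation under the integral sign *)

Section HalfPlaneCalculus.
Variable R : realType.
Implicit Types (c d x y : R) (f g P phi : R * R -> R).

(** The product filter expresses convergence that is uniform for [x] near [x0]; compactness of the
    segment makes it uniform on [[c, d]], so the integrals converge. *)
Lemma cvg_J (I : Type) (F : set_system I) {FF : Filter F} c d
    (g : I -> R -> R) (g0 : R -> R) : c <= d ->
  (\forall i \near F, contI c d (g i)) -> contI c d g0 ->
  (forall x0, c <= x0 <= d ->
     g p.2 p.1 @[p --> filter_prod (nbhs x0) F] --> g0 x0) ->
  J c d (g i) @[i --> F] --> J c d g0.
Proof.
move=> cd cg cg0 gg0; apply/cvgrPdist_le => e e0.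
(* The [+ 1] keeps the denominator positive when [c = d]. *)
pose e' := e / (d - c + 1).
have e'0 : 0 < e' by rewrite divr_gt0//; lra.
have : \forall i \near F, `[c, d] `<=` (fun x => `|g0 x - g i x| <= e').
  have /compact_near_coveringP := @segment_compact R c d.
  apply => x0; rewrite /= in_itv /= => cx0.
  have h1 := gg0 _ cx0.
  move/cvgrPdist_le : h1 => /(_ (e' / 2)); rewrite divr_gt0// => /(_ isT) h1.
  have := cg0 _ cx0 => /cvgrPdist_le /(_ (e' / 2)).
  rewrite divr_gt0// => /(_ isT) h2.
  have h3 : \forall p \near filter_prod (nbhs x0) F, `|g0 x0 - g0 p.1| <= e' / 2.
    by exists ([set x | `|g0 x0 - g0 x| <= e' / 2], setT) => //=;
      [split => //; exact: filterT | move=> [x i] /= []].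
  near=> p; rewrite /=.
  have a1 : `|g0 x0 - g p.2 p.1| <= e' / 2 by near: p.
  have a2 : `|g0 x0 - g0 p.1| <= e' / 2 by near: p.
  rewrite (_ : g0 p.1 - g p.2 p.1 =
    (g0 x0 - g p.2 p.1) - (g0 x0 - g0 p.1)); last by ring.
  by rewrite (le_trans (ler_normB _ _))//; lra.
move=> hF; near=> i.
have cgi : contI c d (g i) by near: i.
have hi : `[c, d] `<=` (fun x => `|g0 x - g i x| <= e') by near: i.
rewrite -JB//; apply: le_trans (J_abs_le (M := e') cd _ _) _.
- by move=> x cx; apply: cvgB; [exact: cg0|exact: cgi].
- by move=> x cx; apply: hi; rewrite /= in_itv.
- rewrite /e' mulrAC ler_pdivrMr; last by lra.
  by rewrite ler_pM2l//; lra.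
Unshelve. all: by end_near. Qed.

Definition contH f := forall z, half_plane z -> {for z, continuous f}.

(** The derivative is a named function in a relation rather than a ['D_] term, so that products and
    compositions with the cut-off are differentiated by the one-variable rules. *)
Definition pdx f g := forall x y, 0 < y ->
  is_derive x 1 (fun t => f (t, y)) (g (x, y)).

Definition pdy f g := forall x y, 0 < y ->
  is_derive y 1 (fun t => f (x, t)) (g (x, y)).

Lemma contH_sx f x y : contH f -> 0 < y -> {for x, continuous (fun t => f (t, y))}.
Proof.
move=> cf y0; apply: (@continuous2_cvg _ _ _ _ (nbhs x) _ id (fun=> y)
  (fun a b => f (a, b))); [|exact: cvg_id|exact: cvg_cst].
have := cf (x, y) y0; rewrite /continuous_at.
by under [X in _ -> X]eq_cvg do rewrite -surjective_pairing.
Qed.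

Lemma contH_sy f x y : contH f -> 0 < y -> {for y, continuous (fun t => f (x, t))}.
Proof.
move=> cf y0; apply: (@continuous2_cvg _ _ _ _ (nbhs y) _ (fun=> x) id
  (fun a b => f (a, b))); [|exact: cvg_cst|exact: cvg_id].
have := cf (x, y) y0; rewrite /continuous_at.
by under [X in _ -> X]eq_cvg do rewrite -surjective_pairing.
Qed.

Lemma contH_Ix f c d y : contH f -> 0 < y -> contI c d (fun t => f (t, y)).
Proof. by move=> cf y0 x _; exact: contH_sx. Qed.

Lemma contH_Iy f c d x : contH f -> 0 < c -> contI c d (fun t => f (x, t)).
Proof. by move=> cf c0 y /andP[cy _]; apply: contH_sy => //; exact: lt_le_trans cy. Qed.

Lemma contH_J f c d y : c <= d -> contH f -> 0 < y ->
  {for y, continuous (fun t => J c d (fun x => f (x, t)))}.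
Proof.
move=> cd cf y0; apply: (@cvg_J _ (nbhs y)) => //.
- near=> t; apply: contH_Ix => //.
  by near: t; exact: lt_nbhsr.
- exact: contH_Ix.
- move=> x0 _; have := cf (x0, y) y0; rewrite /continuous_at.
  by under [X in _ -> X]eq_cvg do rewrite -surjective_pairing.
Unshelve. all: by end_near. Qed.

(** By the mean value theorem the quotient is [phiy (x, th)] with [th] between [y] and [y + k];
    joint continuity of [phiy] gives the locally uniform limit that [cvg_J] requires. *)
Lemma cvg_difference_quotient_y phi phiy x0 y : pdy phi phiy -> contH phiy -> 0 < y ->
  (phi (p.1, p.2 + y) - phi (p.1, y)) / p.2
     @[p --> filter_prod (nbhs x0) (0 : R)^'] --> phiy (x0, y).
Proof.
move=> dphi cphi y0; apply/cvgrPdist_le => e e0.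
have := cphi (x0, y) y0 => /cvgrPdist_le /(_ _ e0) [] [A B] /= [nA nB] AB.
have [r r0 rB] : exists2 r, 0 < r & forall t, `|y - t| < r -> B t.
  by case: nB => r /= r0 rB; exists r.
(* The bound [|k| < y] keeps the segment from [y] to [y + k] inside the half plane. *)
have r'0 : 0 < Num.min r y by rewrite lt_min r0 y0.
exists (A, [set k | `|k| < Num.min r y /\ k != 0]) => /=.
  split => //; rewrite /dnbhs /within /=.
  have h0 : \forall k \near (0 : R), `|k| < Num.min r y by exact: nbhs0_lt.
  by apply: filterS h0 => k kr k0; split.
move=> [x k] /= [Ax [kr k0]].
have {kr}[kr ky] : `|k| < r /\ `|k| < y by move: kr; rewrite lt_min => /andP[].
have [th [thk ->]] : exists th, `|y - th| < r /\
    (phi (x, k + y) - phi (x, y)) / k = phiy (x, th).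
  have dI a b : 0 < a -> a < b -> exists2 t, t \in `]a, b[ &
      phi (x, b) - phi (x, a) = phiy (x, t) * (b - a).
    move=> a0 ab; apply: (@MVT _ (fun t => phi (x, t)) (fun t => phiy (x, t))) => //.
      by move=> t; rewrite in_itv /= => /andP[ta tb]; apply: dphi; exact: lt_trans ta.
    apply: derivable_within_continuous => t; rewrite in_itv /= => /andP[ta tb].
    have : is_derive t 1 (fun t => phi (x, t)) (phiy (x, t)).
      by apply: dphi; exact: lt_le_trans ta.
    by move=> ?; exact: ex_derive.
  have [k_gt0|k_lt0|//] := ltgtP 0 k; last by move=> E; rewrite E eqxx in k0.
  - move: kr ky; rewrite gtr0_norm// => kr ky.
    have [||t] := dI y (k + y) => //; first lra.
    rewrite in_itv /= => /andP[t1 t2] E; exists t; split.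
      by rewrite ltr_norml; apply/andP; split; lra.
    by rewrite E (_ : k + y - y = k) ?mulfK//; ring.
  - move: kr ky; rewrite ltr0_norm// => kr ky.
    have [||t] := dI (k + y) y => //; [lra|lra|].
    rewrite in_itv /= => /andP[t1 t2] E; exists t; split.
      by rewrite ltr_norml; apply/andP; split; lra.
    rewrite -opprB E (_ : y - (k + y) = - k); last by ring.
    by rewrite mulrN opprK mulfK.
by apply: (AB (x, th)); split => //=; exact: rB.
Qed.

Lemma is_derive_quot (F : R -> R) y l :
  (F (k + y) - F y) / k @[k --> (0 : R)^'] --> l -> is_derive y 1 F l.
Proof.
move=> Fl.
have H : h^-1 *: ((F \o shift y) (h *: 1) - F y) @[h --> (0 : R)^'] --> l.
  under eq_cvg do rewrite /= /GRing.scale /= mulr1 mulrC.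
  exact: Fl.
by apply: DeriveDef; [apply/cvg_ex; exists l|exact: cvg_lim H].
Qed.

Lemma dD (f g : R -> R) x df dg : is_derive x 1 f df -> is_derive x 1 g dg ->
  is_derive x 1 (fun t => f t + g t) (df + dg).
Proof. by move=> ? ?; exact: is_deriveD. Qed.

Lemma dB (f g : R -> R) x df dg : is_derive x 1 f df -> is_derive x 1 g dg ->
  is_derive x 1 (fun t => f t - g t) (df - dg).
Proof. by move=> ? ?; exact: is_deriveB. Qed.

Lemma dN (f : R -> R) x df : is_derive x 1 f df ->
  is_derive x 1 (fun t => - f t) (- df).
Proof. by move=> ?; exact: is_deriveN. Qed.

Lemma dM (f g : R -> R) x df dg : is_derive x 1 f df -> is_derive x 1 g dg ->
  is_derive x 1 (fun t => f t * g t) (df * g x + f x * dg).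
Proof.
move=> hf hg; apply: (is_derive_eq (is_deriveM hf hg)).
by rewrite /GRing.scale /= addrC [g x * _]mulrC.
Qed.

Lemma dC (r x : R) : is_derive x 1 (fun=> r) 0.
Proof. exact: is_derive_cst. Qed.

Lemma dI (x : R) : is_derive x 1 (fun t => t) 1.
Proof. exact: is_derive_id. Qed.

Lemma d_comp (h f : R -> R) x dh df : is_derive (f x) 1 h dh ->
  is_derive x 1 f df -> is_derive x 1 (fun t => h (f t)) (dh * df).
Proof.
move=> hh hf; apply: (is_derive_eq (is_derive1_comp hh hf)).
by rewrite /GRing.scale /= mulrC.
Qed.

Lemma is_derive_continuous (f : R -> R) x df : is_derive x 1 f df ->
  {for x, continuous f}.
Proof.
move=> ?; apply: differentiable_continuous.
by apply/derivable1_diffP; apply: ex_derive.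
Qed.

Lemma cD (T : topologicalType) (f g : T -> R) z : {for z, continuous f} ->
  {for z, continuous g} -> {for z, continuous (fun t => f t + g t)}.
Proof. exact: continuousD. Qed.

Lemma cB (T : topologicalType) (f g : T -> R) z : {for z, continuous f} ->
  {for z, continuous g} -> {for z, continuous (fun t => f t - g t)}.
Proof. exact: continuousB. Qed.

Lemma cM (T : topologicalType) (f g : T -> R) z : {for z, continuous f} ->
  {for z, continuous g} -> {for z, continuous (fun t => f t * g t)}.
Proof. exact: continuousM. Qed.

Lemma cN (T : topologicalType) (f : T -> R) z : {for z, continuous f} ->
  {for z, continuous (fun t => - f t)}.
Proof. exact: continuousN. Qed.

Lemma cC (T : topologicalType) (r : R) (z : T) : {for z, continuous (fun=> r)}.
Proof. exact: cvg_cst. Qed.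

(* Weak form of the symmetry of the second derivatives of P, which need not
   exist: they would involve third derivatives of the velocity. *)
Lemma is_derive_weak_flux P Px Py phi phix phiy c d y : c <= d -> 0 < y ->
  pdx P Px -> pdy P Py -> contH Px -> contH Py ->
  pdx phi phix -> pdy phi phiy -> contH phi -> contH phix -> contH phiy ->
  (forall y, 0 < y -> phi (c, y) = 0) -> (forall y, 0 < y -> phi (d, y) = 0) ->
  is_derive y 1 (fun y => J c d (fun x => Px (x, y) * phi (x, y)))
    (J c d (fun x => Px (x, y) * phiy (x, y) - Py (x, y) * phix (x, y))).
Proof.
move=> cd y0 dPx dPy cPx cPy dphix dphiy cphi cphix cphiy phic phid.
apply: is_derive_quot.
(* The difference quotient of [Px * phi] differs from [g k] by the [x]-derivative of [(P (x, k + y)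
   - P (x, y)) / k * phi (x, y)], whose integral is 0 because [phi] vanishes at [c] and [d]. The
   limit of [g k] involves only first derivatives. *)
pose g k x := Px (x, k + y) * ((phi (x, k + y) - phi (x, y)) / k) -
  (P (x, k + y) - P (x, y)) / k * phix (x, y).
have cP t u v : 0 < t -> contI u v (fun x => P (x, t)).
  by move=> t0 x _; exact: is_derive_continuous (dPx x t t0).
have cg k : 0 < k + y -> contI c d (g k).
  move=> ky0 x cx; apply: cB; apply: cM.
  - exact: contH_sx.
  - by apply: cM; [apply: cB; exact: contH_sx|exact: cC].
  - by apply: cM; [apply: cB; apply: (cP _ x x) => //; lra|exact: cC].
  - exact: contH_sx.
have near_pos : \forall k \near (0 : R)^', 0 < k + y.
  apply: filterS (dnbhs0_lt y0) => k.
  by rewrite ltr_norml => /andP[]; lra.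
have near_ne0 : \forall k \near (0 : R)^', k != 0 by exact: nbhs_dnbhs_neq.
have key k : k != 0 -> 0 < k + y -> J c d (g k) =
    (J c d (fun x => Px (x, k + y) * phi (x, k + y)) -
     J c d (fun x => Px (x, y) * phi (x, y))) / k.
  move=> k0 ky0.
  have c1 t : 0 < t -> contI c d (fun x => Px (x, t) * phi (x, t)).
    by move=> t0 x _; apply: cM; exact: contH_sx.
  have c2 : contI c d (fun x => k * g k x).
    by move=> x cx; apply: cM; [exact: cC|exact: cg].
  apply: (mulfI k0); rewrite [RHS]mulrC divfK// -JZ; last exact: cg.
  apply/eqP; rewrite eq_sym -subr_eq0 -JB; [|exact: c1|exact: c1].
  rewrite -JB; [|by move=> x cx; apply: cB; exact: c1|exact: c2].
  pose F x := (P (x, k + y) - P (x, y)) * phi (x, y).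
  have -> : 0 = F d - F c by rewrite /F phic// phid// !mulr0 subrr.
  apply/eqP/J_FTC => //.
  - by move=> x cx; apply: cB; [apply: cB; exact: c1|exact: c2].
  - move=> x cx; apply: (is_derive_eq
      (dM (dB (dPx x _ ky0) (dPx x _ y0)) (dphix x _ y0))).
    by rewrite /g; field.
apply: (cvg_trans (G := J c d (g k) @[k --> (0 : R)^'])).
  apply: near_eq_cvg; near=> k; apply: key.
    by near: k.
  by near: k.
apply: cvg_J => //.
- by apply: filterS near_pos => k; exact: cg.
- by move=> x _; apply: cB; apply: cM; exact: contH_sx.
move=> x0 _; apply: cvgB; apply: cvgM.
- apply: (@continuous2_cvg _ _ _ _ _ _ (fun p => p.1) (fun p => p.2 + y)
    (fun a b => Px (a, b))).
  + have := cPx (x0, y) y0; rewrite /continuous_at.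
    by under [X in _ -> X]eq_cvg do rewrite -surjective_pairing.
  + exact: cvg_fst.
  + rewrite -[X in _ --> X]add0r; apply: cvgD; last exact: cvg_cst.
    by apply: (cvg_trans (cvg_snd)); exact: cvg_within.
- exact: cvg_difference_quotient_y.
- exact: cvg_difference_quotient_y.
- have h := contH_sx (x := x0) cphix y0.
  by apply: (@cvg_comp _ _ _ (@fst R R) (fun a => phix (a, y)) _ _ _ _ h);
    exact: cvg_fst.
Unshelve. all: by end_near. Qed.

(** The [Xx] term integrates to 0, since [X] vanishes at both ends; what remains is differentiation
    under the integral sign. With [X = 0] this is the plain Leibniz rule. *)
Lemma is_derive_divergence X Y Xx Yy c d y : c <= d -> 0 < y ->
  pdx X Xx -> pdy Y Yy -> contH Xx -> contH Y -> contH Yy ->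
  (forall y, 0 < y -> X (c, y) = 0) -> (forall y, 0 < y -> X (d, y) = 0) ->
  is_derive y 1 (fun y => J c d (fun x => Y (x, y)))
    (J c d (fun x => Xx (x, y) + Yy (x, y))).
Proof.
move=> cd y0 dX dY cXx cY cYy Xc Xd.
rewrite JD; [|exact: contH_Ix|exact: contH_Ix].
have -> : J c d (fun x => Xx (x, y)) = X (d, y) - X (c, y).
  by apply: (J_FTC (F := fun x => X (x, y))) => //;
    [exact: contH_Ix|move=> x _; exact: dX].
rewrite Xc// Xd// subrr add0r; apply: is_derive_quot.
pose g k x := (Y (x, k + y) - Y (x, y)) / k.
have cg k : 0 < k + y -> contI c d (g k).
  by move=> ky0 x cx; apply: cM; [apply: cB; exact: contH_sx|exact: cC].
have near_pos : \forall k \near (0 : R)^', 0 < k + y.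
  apply: filterS (dnbhs0_lt y0) => k.
  by rewrite ltr_norml => /andP[]; lra.
apply: (cvg_trans (G := J c d (g k) @[k --> (0 : R)^'])).
  apply: near_eq_cvg; apply: filterS near_pos => k ky0.
  rewrite -JB; [|exact: contH_Ix|exact: contH_Ix].
  rewrite mulrC -JZ; first by apply: J_eq => x _; rewrite mulrC.
  by move=> x cx; apply: cB; exact: contH_sx.
apply: cvg_J => //.
- by apply: filterS near_pos => k; exact: cg.
- exact: contH_Ix.
- by move=> x0 _; exact: cvg_difference_quotient_y.
Qed.

End HalfPlaneCalculus.

(** * The Dirichlet integral *)

Section Plane.
Variable R : realType.
Implicit Types (c d x y r : R) (f g : R * R -> R).
Notation mu := (@lebesgue_measure R).
(* The domain of the product measure: the type [R * R] also carries the product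
   of the canonical structures of [R], which have another display. *)
Notation mR := (measurableTypeR R).
Notation mR2 := (mR * mR)%type.

(** An open set is the countable union of the open rectangles with rational end points that it
    contains; this links the product topology to the product sigma-algebra. *)
Lemma nbhs_prod_measurable (A : set (R * R)) :
  (forall z, A z -> nbhs z A) -> measurable (A : set mR2).
Proof.
move=> oA.
pose rect (q : (rat * rat) * (rat * rat)) : set (R * R) :=
  `]ratr q.1.1, ratr q.1.2[ `*` `]ratr q.2.1, ratr q.2.2[.
have -> : A = \bigcup_q (if `[< rect q `<=` A >] then rect q else set0).
  apply/seteqP; split => [[x y] Axy|z [q _]]; last first.
    by case: ifPn => // /asboolP qA /qA.
  have [[B C] /= [nB nC] BC] := oA _ Axy.
  have itv_rat (D : set R) (t : R) : nbhs t D -> exists a b : rat,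
      ratr a < t < ratr b /\ (forall s, ratr a < s < ratr b -> D s).
    case=> e /= e0 eD.
    have [a] := @rat_in_itvoo R (t - e) t ltac:(lra).
    have [b] := @rat_in_itvoo R t (t + e) ltac:(lra).
    rewrite !in_itv /= => /andP[b1 b2] /andP[a1 a2].
    exists a, b; split; first by rewrite a2 b1.
    move=> s /andP[s1 s2]; apply: eD; rewrite /ball /= ltr_norml.
    by apply/andP; split; lra.
  have [a1 [b1 [h1 k1]]] := itv_rat _ _ nB.
  have [a2 [b2 [h2 k2]]] := itv_rat _ _ nC.
  exists ((a1, b1), (a2, b2)) => //.
  have -> : `[< rect ((a1, b1), (a2, b2)) `<=` A >].
    apply/asboolP => -[s t] /= [/=]; rewrite !in_itv /= => h h'.
    by apply: BC; split => /=; [exact: k1|exact: k2].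
  by split; rewrite /= in_itv.
apply: countable_bigcupT_measurable => // q.
by case: ifP => // _; exact: measurableX.
Qed.

Lemma measurable_half_plane : measurable (@half_plane R : set mR2).
Proof.
apply: nbhs_prod_measurable => -[x y] /= y0.
exists (setT, [set t | 0 < t]) => /=; last by move=> [s t] [].
by split; [exact: filterT|exact: lt_nbhsr].
Qed.

Lemma nbhs_half_plane z : half_plane z -> nbhs z (@half_plane R).
Proof.
case: z => x y /= y0.
exists (setT, [set t | 0 < t]) => /=; last by move=> [s t] [].
by split; [exact: filterT|exact: lt_nbhsr].
Qed.

Lemma contH_measurable f : contH f ->
  measurable_fun (@half_plane R : set mR2) (f : mR2 -> R).
Proof.
move=> cf mD; apply: (measurability _ (measurable_realfun.RGenOInfty.measurableE R)) => //.
move=> _ [_ [r ->] <-]; apply: nbhs_prod_measurable => z [hz /=].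
rewrite in_itv /= andbT => rf; apply: filterI; first exact: nbhs_half_plane.
have := cf z hz; move/(cvgr_gt (f z)) => /(_ _ rf).
by apply: filterS => t; rewrite /= in_itv /= andbT.
Qed.

Lemma EFin_J c d (f : R -> R) : contI c d f ->
  (J c d f)%:E = (\int[mu]_(x in `[c, d]) (f x)%:E)%E.
Proof. by move=> cf; rewrite /J /Rintegral fineK//; exact/integrable_fin_num/contI_integrable. Qed.

Lemma integral_half_plane_ge f c d c' d' : contH f ->
  (forall z, half_plane z -> 0 <= f z) -> c <= d -> 0 < c' ->
  ((J c' d' (fun y => J c d (fun x => f (x, y))))%:E <=
   \int[mu \x mu]_(z in @half_plane R) (f z)%:E)%E.
Proof.
move=> cf f0 cd c'0.
pose box : set mR2 := `[c, d] `*` `[c', d'].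
have mbox : measurable box by exact: measurableX.
have boxH : box `<=` @half_plane R.
  by move=> [x y] [_ /=]; rewrite in_itv /= => /andP[h _]; exact: lt_le_trans h.
have mf : measurable_fun (@half_plane R : set mR2) (fun z : mR2 => (f z)%:E).
  by apply/measurable_EFinP; exact: contH_measurable.
have E : (\int[mu \x mu]_(z in box) (f z)%:E <=
    \int[mu \x mu]_(z in @half_plane R) (f z)%:E)%E.
  by apply: ge0_subset_integral => //; exact: measurable_half_plane.
apply: (le_trans _ E).
rewrite integral_mkcond fubini_tonelli2; last 2 first.
- apply/(measurable_restrictT _ mbox).
  by apply: (measurable_funS _ boxH) => //; exact: measurable_half_plane.
- by move=> z; apply: erestrict_ge0 => t /boxH /f0; rewrite lee_fin.
rewrite EFin_J; last first.
  move=> y /andP[h _]; apply: contH_J => //; exact: lt_le_trans h.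
rewrite integral_mkcond le_eqVlt; apply/orP; left; apply/eqP.
apply: eq_integral => y _; rewrite /fubini_G /patch.
have [/[!inE] /= yc|ync] := boolP (y \in `[c', d']%classic).
  have y0 : 0 < y by move: yc; rewrite in_itv /= => /andP[h _]; exact: lt_le_trans h.
  rewrite EFin_J; last exact: contH_Ix.
  rewrite integral_mkcond; apply: eq_integral => x _; rewrite /patch.
  have -> : ((x, y) \in box) = (x \in `[c, d]%classic).
    by apply/idP/idP; rewrite !inE /box /=; [case|].
  by [].
rewrite integral0_eq// => x _.
case: ifPn => //; rewrite inE => -[_ /= h].
by move: ync; rewrite notin_setE.
Qed.

(** By Tonelli the integrals along vertical lines have a finite integral over the abscissa, so they
    are not all infinite on [[0, 1]]. Taking [x0] in [[0, 1]] puts the line inside every box with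
    [r >= 1]. *)
Lemma vertical_line_integral g : contH g ->
  (forall z, half_plane z -> 0 <= g z) ->
  (\int[mu \x mu]_(z in @half_plane R) (g z)%:E < +oo)%E ->
  exists x0 D0, 0 <= x0 <= 1 /\
    forall c d, 0 < c -> J c d (fun y => g (x0, y)) <= D0.
Proof.
move=> cg g0.
have mH := measurable_half_plane.
have mg : measurable_fun (@half_plane R : set mR2) (fun z : mR2 => (g z)%:E).
  by apply/measurable_EFinP; exact: contH_measurable.
have g0' z : (0 <= ((fun z => (g z)%:E) \_ (@half_plane R)) z)%E.
  by apply: erestrict_ge0 => t /g0; rewrite lee_fin.
have mg' := (measurable_restrictT _ mH).1 mg.
rewrite integral_mkcond fubini_tonelli1//.
set F := fubini_F _ _ => Foo.
have F0 x : (0 <= F x)%E by exact: integral_ge0.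
have [x0 [x01 Fx0]] : exists x0, 0 <= x0 <= 1 /\ (F x0 < +oo)%E.
  apply: contrapT => /forallNP nF; move: Foo; rewrite ltNge => /negP; apply.
  have mF : measurable_fun setT F by exact: measurable_fun_fubini_tonelli_F.
  apply: (@le_trans _ _ (\int[mu]_(x in `[0%R, 1%R]) (F x))%E); last first.
    by apply: ge0_subset_integral => //; exact: measurable_funTS.
  rewrite (@eq_integral _ _ _ _ _ (cst +oo%E)).
    rewrite integral_cst//= lebesgue_measure_itv /= lte_fin ltr01 mulyr.
    by rewrite subr0 gtr0_sg ?ltr01 ?mul1e.
  move=> x; rewrite inE /= in_itv /= => x01.
  apply/eqP; rewrite eq_le leey /= leNgt; apply/negP => Fx.
  by apply: (nF x).
exists x0, (fine (F x0)); split => // c d c0.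
have cJ : contI c d (fun y => g (x0, y)) by exact: contH_Iy.
suff H : ((J c d (fun y => g (x0, y)))%:E <= F x0)%E.
  have Ff : F x0 \is a fin_num by rewrite ge0_fin_numE.
  by move: H; rewrite -{1}(fineK Ff) lee_fin.
rewrite EFin_J// /F /fubini_F.
pose G y := ((fun z => (g z)%:E) \_ (@half_plane R)) (x0, y).
have -> : (\int[mu]_(y in `[c, d]) (g (x0, y))%:E =
    \int[mu]_(y in `[c, d]) G y)%E.
  apply: eq_integral => y; rewrite inE /= in_itv /= => /andP[h _].
  by rewrite /G /patch mem_set//; exact: lt_le_trans h.
apply: ge0_subset_integral => //.
- exact: (measurable_fun_pair2 x0 mg').
- by move=> y _; exact: g0'.
Qed.

(** Dominated convergence with majorant [g]: the truncated weights
    [min (1, (1 + |x| + y) / (n + 1))] are at most 1 and tend to 0 pointwise. *)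
Lemma dirichlet_weighted_tail g : contH g -> (forall z, half_plane z -> 0 <= g z) ->
  (\int[mu \x mu]_(z in @half_plane R) (g z)%:E < +oo)%E ->
  forall e : R, 0 < e -> exists2 r0, 1 <= r0 & forall r dl : R, r0 <= r -> 0 < dl ->
    J dl r (fun y => J (- r) r
      (fun x => g (x, y) * ((1 + `|x| + y) / r))) <= e.
Proof.
move=> cg g0 goo e e0.
have mH := measurable_half_plane.
pose w (n : nat) (z : R * R) := Num.min 1 ((1 + `|z.1| + z.2) / n.+1%:R).
have cw n : contH (w n).
  move=> z _; apply: continuous_min; first exact: cC.
  apply: cM; last exact: cC.
  apply: cD; last exact: cvg_snd.
  apply: cD; first exact: cC.
  by apply: (cvg_norm (f := fst)); exact: cvg_fst.
have w01 n z : half_plane z -> 0 <= w n z <= 1.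
  move=> hz; have z0 : 0 < z.2 by exact: hz.
  rewrite /w ge_min lexx /= andbT le_min ler01 /= divr_ge0//.
  by have := normr_ge0 z.1; lra.
have wlim z : half_plane z -> (g z * w n z)%:E @[n --> \oo] --> 0%:E.
  move=> hz; pose s := 1 + `|z.1| + z.2.
  have s0 : 0 <= s by have z0 : 0 < z.2 := hz; rewrite /s; have := normr_ge0 z.1; lra.
  have L : g z * w n z @[n --> \oo] --> (0 : R).
    have L1 : g z * s * harmonic n @[n --> \oo] --> (0 : R).
      rewrite -[X in _ --> X](mulr0 (g z * s)).
      by apply: cvgM; [exact: cvg_cst|exact: cvg_harmonic].
    apply: (squeeze_cvgr _ (cvg_cst 0) L1).
    apply: nearW => n /=; have /andP[w0 _] := w01 n z hz.
    rewrite mulr_ge0 ?g0//= -mulrA ler_wpM2l ?g0//.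
    by rewrite /w ge_min lexx orbT.
  by apply: cvg_EFin => //; exact: nearW.
have mg : measurable_fun (@half_plane R : set mR2) (fun z : mR2 => (g z)%:E).
  by apply/measurable_EFinP; exact: contH_measurable.
have ig : (mu \x mu)%E.-integrable (@half_plane R) (fun z => (g z)%:E).
  apply/integrableP; split => //.
  have -> : (\int[mu \x mu]_(z in @half_plane R) `|(g z)%:E| =
     \int[mu \x mu]_(z in @half_plane R) (g z)%:E)%E; last by [].
  apply: eq_integral => z; rewrite inE => hz.
  by rewrite gee0_abs// lee_fin g0.
have cgw n : contH (fun z => g z * w n z).
  by move=> z hz; apply: cM; [exact: cg|exact: cw].
have [_ _] : [/\ (mu \x mu)%E.-integrable (@half_plane R) (cst 0%E),
  [sequence \int[(mu \x mu)%E]_(z in @half_plane R) `|(g z * w n z)%:E - cst 0 z|%E]_n @ \oo --> 0%E &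
  [sequence \int[(mu \x mu)%E]_(z in @half_plane R) (g z * w n z)%:E]_n @ \oo -->
    \int[(mu \x mu)%E]_(z in @half_plane R) cst 0 z]%E.
  apply: (@dominated_convergence _ _ _ _ _ mH _ _ (fun z => (g z)%:E)) => //.
  - by move=> n; apply/measurable_EFinP; exact: contH_measurable.
  - by apply: aeW => z; exact: wlim.
  - apply: aeW => z n hz; have /andP[w0 w1] := w01 n z hz.
    rewrite gee0_abs lee_fin; first by rewrite ler_piMr ?g0.
    by rewrite mulr_ge0 ?g0.
rewrite integral0.
move=> /fine_cvgP[_] /cvgrPdist_le /(_ (e / 3)).
rewrite divr_gt0// => /(_ isT) [N _ HN].
exists N.+1%:R; first by rewrite ler1n.
move=> r dl rN dl0; have r0 : 0 < r by apply: lt_le_trans rN; rewrite ltr0n.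
have := HN N (leqnn N); rewrite /= sub0r normrN.
set I := (\int[_]_(_ in _) _)%E.
have I0 : (0 <= I)%E.
  apply: integral_ge0 => z hz; rewrite lee_fin mulr_ge0 ?g0//.
  by have /andP[] := w01 N z hz.
have Ioo : (I < +oo)%E.
  apply: le_lt_trans goo; apply: ge0_le_integral => //.
  - by move=> z hz; rewrite lee_fin mulr_ge0 ?g0//; have /andP[] := w01 N z hz.
  - by apply/measurable_EFinP; exact: contH_measurable.
  - move=> z hz; have /andP[w0 w1] := w01 N z hz.
    by rewrite lee_fin ler_piMr ?g0.
rewrite ger0_norm ?fine_ge0// => Ie.
have gw0 z : half_plane z -> 0 <= g z * w N z.
  by move=> hz; rewrite mulr_ge0 ?g0//; have /andP[] := w01 N z hz.
have rr : - r <= r by lra.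
have JI := @integral_half_plane_ge _ (- r) r dl r (cgw N) gw0 rr dl0.
have If : I \is a fin_num by rewrite ge0_fin_numE.
move: JI; rewrite -[X in (_ <= X)%E](fineK If) lee_fin => JI.
have cwt : contH (fun z => g z * ((1 + `|z.1| + z.2) / r)).
  move=> z hz; apply: cM; first exact: cg.
  apply: cM; last exact: cC.
  apply: cD; last exact: cvg_snd.
  apply: cD; first exact: cC.
  by apply: (cvg_norm (f := fst)); exact: cvg_fst.
have c3 : contH (fun z => 3 * (g z * w N z)).
  by move=> z hz; apply: cM; [exact: cC|exact: cgw].
(* For [r >= N + 1] the weight [(1 + |x| + y) / r] is at most 3 times the truncated weight of index
   [N]: where the latter is 1, because [1 + |x| + y <= 3 r] on the box; elsewhere, because
   [N + 1 <= r]. *)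
apply: (@le_trans _ _ (3 * (e / 3))); last by rewrite mulrC divfK.
apply: (@le_trans _ _ (3 * J dl r (fun y => J (- r) r (fun x => g (x, y) * w N (x, y))))); last first.
  by rewrite ler_pM2l//; exact: le_trans JI Ie.
have cJ : contI dl r (fun y => J (- r) r (fun x => g (x, y) * w N (x, y))).
  move=> y /andP[h _]; apply: (contH_J rr (cgw N)).
  exact: lt_le_trans h.
have cJt : contI dl r
    (fun y => J (- r) r (fun x => g (x, y) * ((1 + `|x| + y) / r))).
  move=> y /andP[h _]; apply: (contH_J rr cwt).
  exact: lt_le_trans h.
rewrite -JZ//; apply: J_le => //.
  by move=> y cy; apply: cM; [exact: cC|exact: cJ].
move=> y /andP[dy yr]; have y0 : 0 < y by exact: lt_le_trans dy.
have cx1 := contH_Ix (c := - r) (d := r) (cgw N) y0.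
have cx2 := contH_Ix (c := - r) (d := r) cwt y0.
have cx3 := contH_Ix (c := - r) (d := r) c3 y0.
rewrite -JZ//; apply: J_le => //.
move=> x /andP[x1 x2]; rewrite [leRHS]mulrCA ler_wpM2l ?g0//.
have xr : `|x| <= r by rewrite ler_norml x1 x2.
have x0 := normr_ge0 x.
have r1 : 1 <= r by apply: le_trans rN; rewrite ler1n.
rewrite /w /= /Num.min; case: ifP => _; first by rewrite mulr1 ler_pdivrMr//; lra.
have s0 : 0 <= 1 + `|x| + y by lra.
apply: (@le_trans _ _ ((1 + `|x| + y) / N.+1%:R)).
  by rewrite ler_wpM2l// lef_pV2 ?posrE.
rewrite -[leLHS]mul1r ler_wpM2r ?ler1n//.
by rewrite divr_ge0.
Qed.

End Plane.

(** * Boundary values and mixed partial derivatives *)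

Section Boundary.
Variable R : realType.
Implicit Types (x y r e : R) (f g v : R * R -> R) (z : R * R).

Lemma extends_contH f : extends_continuously f -> contH f.
Proof.
case=> g /subspace_continuousP cg gf z hz.
have hz' : z.2 >= 0 by exact: ltW.
have hn : \forall t \near z, closed_half_plane t.
  by apply: filterS (nbhs_half_plane hz) => t; exact: ltW.
have gz : g t @[t --> within (@closed_half_plane R) (nbhs z)] --> f z.
  by rewrite -(gf z hz); exact: (cg z hz').
apply: (cvg_trans (G := g t @[t --> z])).
  apply: near_eq_cvg; apply: filterS (nbhs_half_plane hz) => t ht.
  by rewrite gf.
move=> A /gz; rewrite /nbhs /= /within /= => h.
by apply: filterS2 hn h => t ? /(_ _); apply.
Qed.

Lemma extends_bounded f r : extends_continuously f -> exists M,
  forall x y, `|x| <= r -> 0 < y <= r -> `|f (x, y)| <= M.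
Proof.
case=> g cg gf; pose K : set (R * R) := `[- r, r] `*` `[0, r].
have KH : K `<=` @closed_half_plane R.
  by move=> [x y] [_] /=; rewrite in_itv /= => /andP[].
have cK : compact K by apply: compact_setX; exact: segment_compact.
have [M [_ HM]] := compact_bounded (continuous_compact (continuous_subspaceW KH cg) cK).
exists (M + 1) => x y xr /andP[y0 yr]; rewrite -gf//.
apply: (HM (M + 1)); first by rewrite ltrDl.
exists (x, y) => //; split; rewrite /= in_itv /=.
  by move: xr; rewrite ler_norml.
by rewrite ltW.
Qed.

Lemma has_partials_pdx f : has_partials f -> pdx f (dx f).
Proof.
move=> hf x y y0; have [h _] := hf (x, y) y0.
have E : (fun h : R => h^-1 *: ((f \o shift (x, y)) (h *: ((1, 0) : R * R)) - f (x, y))) =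
  (fun h : R => h^-1 *: (((fun t => f (t, y)) \o shift x) (h *: 1) - f (x, y))).
  apply/funext => k /=; congr (_ *: (f _ - _)).
  change ((k *: 1 + x, k *: 0 + y) = (k *: 1 + x, y)).
  by rewrite scaler0 add0r.
apply: DeriveDef; first by move: h; rewrite /derivable E.
by rewrite /dx /derive E.
Qed.

Lemma has_partials_pdy f : has_partials f -> pdy f (dy f).
Proof.
move=> hf x y y0; have [_ h] := hf (x, y) y0.
have E : (fun h : R => h^-1 *: ((f \o shift (x, y)) (h *: ((0, 1) : R * R)) - f (x, y))) =
  (fun h : R => h^-1 *: (((fun t => f (x, t)) \o shift y) (h *: 1) - f (x, y))).
  apply/funext => k /=; congr (_ *: (f _ - _)).
  change ((k *: 0 + x, k *: 1 + y) = (x, k *: 1 + y)).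
  by rewrite scaler0 add0r.
apply: DeriveDef; first by move: h; rewrite /derivable E.
by rewrite /dy /derive E.
Qed.

(** Compactness of [[- r, r]] makes the limits at single boundary points uniform. *)
Lemma boundary_uniform f r e : (forall x, boundary_value f x 0) -> 0 < e ->
  exists2 d0, 0 < d0 & forall x y, `|x| <= r -> 0 < y < d0 -> `|f (x, y)| <= e.
Proof.
move=> bf e0.
have : \forall y \near (0 : R)^'+, `[- r, r] `<=` (fun x => `|f (x, y)| <= e).
  have /compact_near_coveringP := @segment_compact R (- r) r.
  apply => x0 _; have /cvgrPdist_le /(_ e e0) := bf x0.
  rewrite /within /= => -[[A B] /= [nA nB] AB].
  exists (A, [set y | B y /\ 0 < y]) => /=.
    split => //; rewrite /at_right /within /=.
    by apply: filterS nB.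
  move=> [x y] /= [Ax [By y0]].
  by have := AB (x, y) (conj Ax By) y0; rewrite sub0r normrN.
rewrite /at_right /within /= => -[d0 /= d00 Hd].
exists d0 => // x y xr /andP[y0 yd].
apply: (Hd y) => //=; first by rewrite /= sub0r normrN gtr0_norm.
by rewrite in_itv /= -ler_norml.
Qed.

(** If [vx] had a limit [L <> 0] at [(x0, 0)], then on a horizontal segment of length [r / 2] close
    to the boundary [v] would vary by at least [r |L| / 4], by the mean value theorem. But
    [|v| <= r |L| / 16] at both ends allows at most [r |L| / 8]. Together with the condition on [uy]
    this gives [w = 0] on the boundary. *)
Lemma boundary_value_dx v vx : pdx v vx -> extends_continuously vx ->
  (forall x, boundary_value v x 0) -> forall x, boundary_value vx x 0.
Proof.
move=> dv [g /subspace_continuousP cg gv] bv x0.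
have g0 : g t @[t --> within (@closed_half_plane R) (nbhs (x0, 0))] --> g (x0, 0).
  by apply: cg; rewrite /closed_half_plane /=.
have vg : vx t @[t --> within (@half_plane R) (nbhs (x0, 0))] --> g (x0, 0).
  move=> A /g0; rewrite /nbhs /= /within /=.
  apply: filterS => t ht t0; rewrite -gv//; apply: ht; exact: ltW.
suff g00 : g (x0, 0) = 0 by move: vg; rewrite g00.
apply/eqP/negPn/negP => gn0; set L := g (x0, 0) in vg gn0.
have L0 : 0 < `|L| by rewrite normr_gt0.
have L2 : 0 < `|L| / 2 by rewrite divr_gt0.
have /cvgrPdist_le /(_ _ L2) := vg.
rewrite /within /= => -[[A B] /= [[r /= r0 rA] [s /= s0 sB]] AB].
have rL : 0 < r * `|L| / 16 by rewrite divr_gt0// mulr_gt0.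
have [d0 d00 Hd] := boundary_uniform (`|x0| + r) bv rL.
pose y := Num.min s d0 / 2.
have y0 : 0 < y by rewrite divr_gt0// lt_min s0.
have ym : y < Num.min s d0 by rewrite ltr_pdivrMr// ltr_pMr ?lt_min ?s0// ltr1n.
have /andP[ys yd] : (y < s) && (y < d0) by rewrite -lt_min.
have [|t _||t] := @MVT R (fun t => v (t, y)) (fun t => vx (t, y)) x0 (x0 + r / 2).
- lra.
- exact: dv.
- apply: derivable_within_continuous => u _.
  by have ? := dv u y y0; exact: ex_derive.
rewrite in_itv /= => /andP[t1 t2] E.
have : `|L - vx (t, y)| <= `|L| / 2.
  apply: (AB (t, y)) => //=; split => /=.
    by apply: rA; rewrite /= ltr_norml; apply/andP; split; lra.
  by apply: sB; rewrite /= sub0r normrN gtr0_norm.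
have b1 : `|v (x0, y)| <= r * `|L| / 16.
  by apply: Hd; rewrite ?y0 ?yd//; lra.
have b2 : `|v (x0 + r / 2, y)| <= r * `|L| / 16.
  apply: Hd; rewrite ?y0 ?yd//; apply: le_trans (ler_normD _ _) _.
  by rewrite (ger0_norm (x := r / 2)); lra.
have := ler_normB (v (x0 + r / 2, y)) (v (x0, y)).
rewrite E normrM (ger0_norm (x := x0 + r / 2 - x0)); last by lra.
have := ler_normD (L - vx (t, y)) (vx (t, y)); rewrite subrK => h1 h2 h3.
have : `|L| / 2 <= `|vx (t, y)| by lra.
move=> h4; have : `|L| / 2 * (r / 2) <= `|vx (t, y)| * (x0 + r / 2 - x0).
  by rewrite ler_pM//; lra.
have : 0 < r * `|L| by rewrite mulr_gt0.
lra.
Qed.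

(** If [k x0 <> 0], then [k] stays within [|k x0| / 2] of [k x0] on a short segment, whose integral
    cannot vanish. *)
Lemma eq0_of_integrals (k : R -> R) x0 : (forall x, {for x, continuous k}) ->
  (forall d, x0 <= d -> J x0 d k = 0) -> k x0 = 0.
Proof.
move=> ck k0; apply/eqP/negPn/negP => kn0.
have m0 : 0 < `|k x0| / 2 by rewrite divr_gt0 ?normr_gt0.
have := ck x0 => /cvgrPdist_le /(_ _ m0) [r /= r0 rk].
have ckc : contI x0 (x0 + r / 2) (fun x => k x - k x0).
  by move=> x _; apply: cB; [exact: ck|exact: cC].
have x0r : x0 <= x0 + r / 2 by lra.
have := J_abs_le (M := `|k x0| / 2) x0r ckc.
rewrite JB; [|by move=> x _; exact: ck|by move=> x _; exact: cC].
rewrite k0// J_cst// sub0r normrN normrM (ger0_norm (x := x0 + r / 2 - x0)); last by lra.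
have H x : x0 <= x <= x0 + r / 2 -> `|k x - k x0| <= `|k x0| / 2.
  move=> /andP[x1 x2]; rewrite distrC; apply: rk => /=.
  by rewrite ltr_norml; apply/andP; split; lra.
move=> /(_ H); rewrite ler_pM2r; last by lra.
lra.
Qed.

Lemma is_derive_eq_on_pos (F G : R -> R) y l : 0 < y ->
  (forall t, 0 < t -> F t = G t) -> is_derive y 1 F l -> is_derive y 1 G l.
Proof.
move=> y0 FG dF; apply: near_eq_is_derive dF.
by apply: filterS (lt_nbhsr y0) => t; exact: FG.
Qed.

(** The [y]-derivative of the integral of [fx] over [[x0, d]] is computed twice: under the integral
    sign it is the integral of [fxy]; through [f (d, y) - f (x0, y)] it is [fy (d, y) - fy (x0, y)],
    the integral of [fyx]. Then [d] varies. *)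
Lemma mixed_partials f fx fy fxy fyx z : pdx f fx -> pdy f fy ->
  pdy fx fxy -> pdx fy fyx -> contH fx -> contH fxy -> contH fyx ->
  half_plane z -> fxy z = fyx z.
Proof.
case: z => x0 y fdx fdy fxdy fydx cfx cfxy cfyx y0.
apply/eqP; rewrite -subr_eq0; apply/eqP.
apply: (@eq0_of_integrals (fun x => fxy (x, y) - fyx (x, y))).
  by move=> x; apply: cB; exact: contH_sx.
move=> d xd.
rewrite JB; [|exact: contH_Ix|exact: contH_Ix].
have E2 : J x0 d (fun x => fyx (x, y)) = fy (d, y) - fy (x0, y).
  apply: (J_FTC (F := fun x => fy (x, y))) => //; first exact: contH_Ix.
  by move=> x _; exact: fydx.
have d1 : is_derive y 1 (fun y => J x0 d (fun x => fx (x, y)))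
    (J x0 d (fun x => 0 + fxy (x, y))).
  apply: (@is_derive_divergence R (fun=> 0) fx (fun=> 0)) => //.
  - by move=> *; exact: dC.
  - by move=> *; exact: cC.
have d2 : is_derive y 1 (fun y => f (d, y) - f (x0, y)) (fy (d, y) - fy (x0, y)).
  by apply: dB; exact: fdy.
have d3 : is_derive y 1 (fun y => J x0 d (fun x => fx (x, y))) (fy (d, y) - fy (x0, y)).
  apply: is_derive_eq_on_pos d2 => // t t0; apply/esym/(J_FTC (F := fun x => f (x, t))) => //.
    exact: contH_Ix.
  by move=> x _; exact: fdx.
have -> : J x0 d (fun x => fxy (x, y)) = J x0 d (fun x => 0 + fxy (x, y)).
  by apply: J_eq => x _; rewrite add0r.
by rewrite E2 -(@derive_val _ _ _ _ _ _ _ d1) (@derive_val _ _ _ _ _ _ _ d3) subrr.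
Qed.

End Boundary.

Lemma is_derive_cast (R : realType) (f : R -> R) (x df df' : R) :
  is_derive x 1 f df -> df = df' -> is_derive x 1 f df'.
Proof. by move=> h <-. Qed.

Lemma dX2 (R : realType) (f : R -> R) (x df : R) : is_derive x 1 f df ->
  is_derive x 1 (fun t => f t ^+ 2) (2 * f x * df).
Proof.
move=> h; have E : (fun t => f t ^+ 2) = (fun t => f t * f t).
  by apply/funext => s; rewrite expr2.
by rewrite E; apply: (is_derive_cast (dM h h)); ring.
Qed.

(* [notypeclasses refine]: otherwise the [is_derive] premises are discharged by
   type class instances, with derivatives in a form [ring] does not recognize. *)
Ltac der := lazymatch goal with
  | |- is_derive _ _ (fun t => t) _ => notypeclasses refine (dI _)
  | |- is_derive _ _ (fun t => @?f t + - @?g t) _ =>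
      notypeclasses refine (dB (f := f) (g := g) _ _); der
  | |- is_derive _ _ (fun t => @?f t + @?g t) _ =>
      notypeclasses refine (dD (f := f) (g := g) _ _); der
  | |- is_derive _ _ (fun t => @?f t * @?g t) _ =>
      notypeclasses refine (dM (f := f) (g := g) _ _); der
  | |- is_derive _ _ (fun t => - @?f t) _ =>
      notypeclasses refine (dN (f := f) _); der
  | |- is_derive _ _ (fun t => @?f t ^+ 2) _ =>
      notypeclasses refine (dX2 (f := f) _); der
  | _ => first [eassumption | notypeclasses refine (dC _ _)]
  end.

(** * Integrals over boxes *)

Section Boxes.
Variable R : realType.
Implicit Types (x y r t dl k : R) (f g : R * R -> R) (z : R * R).

(** The bottom edge is at height [dl > 0] because the functions are controlled only in the open half
    plane. With [y] outside, the integral of a divergence is a difference of fluxes through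
    horizontal edges. *)
Definition boxint r dl f : R := J dl r (fun y => J (- r) r (fun x => f (x, y))).

Lemma contI_boxint f r dl : 0 < r -> 0 < dl -> contH f ->
  contI dl r (fun y => J (- r) r (fun x => f (x, y))).
Proof.
move=> r0 d0 cf y /andP[dy _]; apply: contH_J => //; first by lra.
exact: lt_le_trans dy.
Qed.

Lemma boxint_le f g r dl : 0 < r -> 0 < dl -> contH f -> contH g ->
  (forall x y, `|x| <= r -> dl <= y <= r -> f (x, y) <= g (x, y)) ->
  boxint r dl f <= boxint r dl g.
Proof.
move=> r0 d0 cf cg fg; apply: J_le; [exact: contI_boxint|exact: contI_boxint|].
move=> y yr; have y0 : 0 < y by case/andP: yr => + _; exact: lt_le_trans.
apply: J_le; [exact: contH_Ix|exact: contH_Ix|].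
by move=> x; rewrite -ler_norml => xr; exact: fg.
Qed.

Lemma boxint_eq f g r dl :
  (forall x y, `|x| <= r -> dl <= y <= r -> f (x, y) = g (x, y)) ->
  boxint r dl f = boxint r dl g.
Proof.
move=> fg; apply: J_eq => y yr; apply: J_eq => x.
by rewrite -ler_norml => xr; exact: fg.
Qed.

Lemma boxint_D f g r dl : 0 < r -> 0 < dl -> contH f -> contH g ->
  boxint r dl (fun z => f z + g z) = boxint r dl f + boxint r dl g.
Proof.
move=> r0 d0 cf cg; rewrite /boxint -JD; [|exact: contI_boxint|exact: contI_boxint].
apply: J_eq => y /andP[dy _]; have y0 : 0 < y by exact: lt_le_trans dy.
by apply: JD; exact: contH_Ix.
Qed.

Lemma boxint_Z f k r dl : 0 < r -> 0 < dl -> contH f ->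
  boxint r dl (fun z => k * f z) = k * boxint r dl f.
Proof.
move=> r0 d0 cf; rewrite /boxint -JZ; last exact: contI_boxint.
apply: J_eq => y /andP[dy _]; have y0 : 0 < y by exact: lt_le_trans dy.
by apply: JZ; exact: contH_Ix.
Qed.

Lemma boxint_flux (Y S : R * R -> R) r dl : 0 < dl -> dl <= r -> contH S ->
  (forall y, 0 < y -> is_derive y 1 (fun y => J (- r) r (fun x => Y (x, y)))
     (J (- r) r (fun x => S (x, y)))) ->
  boxint r dl S = J (- r) r (fun x => Y (x, r)) - J (- r) r (fun x => Y (x, dl)).
Proof.
move=> d0 dr cS dY; apply: (J_FTC (F := fun y => J (- r) r (fun x => Y (x, y)))) => //.
  by apply: contI_boxint => //; lra.
by move=> y /andP[dy _]; apply: dY; exact: lt_le_trans dy.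
Qed.

(** A polynomial used only on [[- r, r]], never extended by 0. Its double zeros at [r] and [- r]
    make the cut-off and its gradient vanish on the edges, which is all that two integrations by
    parts require. *)
Definition chi r t : R := (1 - (t / r) ^+ 2) ^+ 2.
Definition chi1 r t : R := - 4 * t / r ^+ 2 * (1 - (t / r) ^+ 2).
Definition chi2 r t : R := - 4 / r ^+ 2 + 12 * t ^+ 2 / r ^+ 4.

Lemma d_chi (r t : R) : r != 0 -> is_derive t 1 (chi r) (chi1 r t).
Proof.
move=> r0; rewrite /chi /chi1.
by notypeclasses refine (is_derive_cast _ _); [der|rewrite /=; field].
Qed.

Lemma d_chi1 (r t : R) : r != 0 -> is_derive t 1 (chi1 r) (chi2 r t).
Proof.
move=> r0; rewrite /chi1 /chi2.
by notypeclasses refine (is_derive_cast _ _); [der|rewrite /=; field].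
Qed.

Lemma chi_r r : r != 0 -> chi r r = 0.
Proof. by move=> r0; rewrite /chi divff// expr1n subrr expr0n. Qed.

Lemma chi_Nr r : r != 0 -> chi r (- r) = 0.
Proof. by move=> r0; rewrite /chi mulNr divff// sqrrN expr1n subrr expr0n. Qed.

Lemma chi1_r r : r != 0 -> chi1 r r = 0.
Proof. by move=> r0; rewrite /chi1 divff// expr1n subrr mulr0. Qed.

Lemma chi1_Nr r : r != 0 -> chi1 r (- r) = 0.
Proof. by move=> r0; rewrite /chi1; field. Qed.

Lemma ratio_sq r t : 0 < r -> `|t| <= r -> 0 <= (t / r) ^+ 2 <= 1.
Proof.
move=> r0 tr; rewrite sqr_ge0 /= -real_normK ?num_real// expr_le1//.
by rewrite normrM normfV (gtr0_norm r0) ler_pdivrMr// mul1r.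
Qed.

Lemma chi_01 r t : 0 < r -> `|t| <= r -> 0 <= chi r t <= 1.
Proof.
move=> r0 tr; have /andP[h0 h1] := ratio_sq r0 tr.
by rewrite /chi sqr_ge0 /= expr_le1//; lra.
Qed.

Lemma chi1_le r t : 0 < r -> `|t| <= r -> `|chi1 r t| <= 4 * `|t| / r ^+ 2.
Proof.
move=> r0 tr; have /andP[h0 h1] := ratio_sq r0 tr.
rewrite /chi1 !normrM normrN normfV (ger0_norm (x := 4))// normrX (gtr0_norm r0).
have h2 : 0 <= 4 * `|t| / r ^+ 2.
  by apply: divr_ge0; [exact: mulr_ge0|exact: sqr_ge0].
have h3 : `|1 - (t / r) ^+ 2| <= 1 by rewrite ger0_norm ?subr_ge0// gerBl.
by rewrite ler_piMr.
Qed.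

Lemma chi2_le r t : 0 < r -> `|t| <= r -> `|chi2 r t| <= 8 / r ^+ 2.
Proof.
move=> r0 tr; have /andP[h0 h1] := ratio_sq r0 tr.
have -> : chi2 r t = (- 4 + 12 * (t / r) ^+ 2) / r ^+ 2.
  by rewrite /chi2; field; rewrite gt_eqF.
rewrite normrM normfV (gtr0_norm (x := r ^+ 2)) ?exprn_gt0//.
rewrite ler_wpM2r ?invr_ge0 ?sqr_ge0//.
by rewrite ler_norml; apply/andP; split; lra.
Qed.

Lemma chi_half r t : 0 < r -> `|t| <= r / 2 -> 1 / 2 <= chi r t.
Proof.
move=> r0 tr; rewrite /chi.
have h : (t / r) ^+ 2 <= 1 / 4.
  rewrite -real_normK ?num_real// normrM normfV (gtr0_norm r0).
  have h1 : `|t| / r <= 1 / 2 by rewrite ler_pdivrMr//; lra.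
  have h2 : 0 <= `|t| / r by rewrite divr_ge0// ltW.
  by rewrite expr2; nra.
by rewrite expr2; nra.
Qed.

Lemma contH_fst (h : R -> R) : continuous h -> contH (fun z => h z.1).
Proof.
move=> ch z _; apply: (@continuous_comp _ _ _ fst h); first exact: cvg_fst.
exact: ch.
Qed.

Lemma contH_snd (h : R -> R) : continuous h -> contH (fun z => h z.2).
Proof.
move=> ch z _; apply: (@continuous_comp _ _ _ snd h); first exact: cvg_snd.
exact: ch.
Qed.

Lemma contH_comp (h : R -> R) f : continuous h -> contH f ->
  contH (fun z => h (f z)).
Proof. by move=> ch cf z hz; apply: (@continuous_comp _ _ _ f h); [exact: cf|exact: ch]. Qed.

(** The derivative of [(x - m) f^2] is [f^2 + 2 (x - m) f f'], and twice this is at least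
    [f^2 - 4 L^2 f'^2], because [(f + 2 (x - m) f')^2 >= 0] and [|x - m| <= L]. The constant [B]
    bounds the boundary terms. *)
Lemma hardy (f df : R -> R) c d m B L : c <= d ->
  (forall x, is_derive x 1 f (df x)) -> (forall x, {for x, continuous df}) ->
  (d - m) * f d ^+ 2 - (c - m) * f c ^+ 2 <= B ->
  (forall x, c <= x <= d -> `|x - m| <= L) ->
  J c d (fun x => f x ^+ 2) <= 2 * B + 4 * L ^+ 2 * J c d (fun x => df x ^+ 2).
Proof.
move=> cd fdf cdf hB hL.
have cf x : {for x, continuous f} by exact: is_derive_continuous (fdf x).
have c2 (g : R -> R) : (forall x, {for x, continuous g}) ->
    forall x, {for x, continuous (fun x => g x ^+ 2)}.
  by move=> cg x; apply: (cM (f := g) (g := g)); exact: cg.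
have cg : contI c d (fun x => f x ^+ 2 + 2 * (x - m) * (f x * df x)).
  move=> x _; apply: cD; first exact: c2.
  apply: cM; last by apply: cM; [exact: cf|exact: cdf].
  by apply: cM; [exact: cC|apply: cB; [exact: cvg_id|exact: cC]].
have E : J c d (fun x => f x ^+ 2 + 2 * (x - m) * (f x * df x)) =
    (d - m) * f d ^+ 2 - (c - m) * f c ^+ 2.
  apply: (J_FTC (F := fun x => (x - m) * f x ^+ 2)) => // x _.
  have hf := fdf x.
  by notypeclasses refine (is_derive_cast _ _); [der|rewrite /=; ring].
have cl : contI c d (fun x => f x ^+ 2 - 4 * L ^+ 2 * df x ^+ 2).
  move=> x _; apply: cB; first exact: c2.
  by apply: cM; [exact: cC|exact: c2].
have : J c d (fun x => f x ^+ 2 - 4 * L ^+ 2 * df x ^+ 2) <= 2 * B.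
  apply: (@le_trans _ _ (2 * J c d (fun x => f x ^+ 2 + 2 * (x - m) * (f x * df x)))).
    rewrite -JZ//; apply: J_le => //.
      by move=> x cx; apply: cM; [exact: cC|exact: cg].
    move=> x cx; have := hL x cx.
    have L0 : 0 <= L by apply: le_trans (hL x cx).
    move=> h; have h2 : (x - m) ^+ 2 <= L ^+ 2.
      by rewrite -[leLHS]real_normK ?num_real// ler_pXn2r// nnegrE.
    have h3 : (x - m) ^+ 2 * df x ^+ 2 <= L ^+ 2 * df x ^+ 2.
      by rewrite ler_wpM2r// sqr_ge0.
    have := sqr_ge0 (f x + 2 * (x - m) * df x).
    have -> : (f x + 2 * (x - m) * df x) ^+ 2 = f x ^+ 2 + 4 * (x - m) * (f x * df x)
      + 4 * ((x - m) ^+ 2 * df x ^+ 2) by ring.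
    lra.
  by rewrite E ler_pM2l.
rewrite JB; [|by move=> x _; exact: c2|]; last first.
  by move=> x _; apply: cM; [exact: cC|exact: c2].
rewrite JZ; last by move=> x _; exact: c2.
lra.
Qed.

End Boxes.

(** * Hardy inequalities on boxes, and vanishing from cut-off integrals *)

Section Estimates.
Variable R : realType.
Implicit Types (x y r t dl k : R) (f g u v : R * R -> R) (z : R * R).

Lemma contH_D f g : contH f -> contH g -> contH (fun z => f z + g z).
Proof. by move=> cf cg z hz; apply: cD; [exact: cf|exact: cg]. Qed.

Lemma contH_B f g : contH f -> contH g -> contH (fun z => f z - g z).
Proof. by move=> cf cg z hz; apply: cB; [exact: cf|exact: cg]. Qed.

Lemma contH_M f g : contH f -> contH g -> contH (fun z => f z * g z).
Proof. by move=> cf cg z hz; apply: cM; [exact: cf|exact: cg]. Qed.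

Lemma contH_N f : contH f -> contH (fun z => - f z).
Proof. by move=> cf z hz; apply: cN; exact: cf. Qed.

Lemma contH_C k : contH (fun=> k).
Proof. by move=> z _; exact: cC. Qed.

Lemma contH_X f : contH f -> contH (fun z => f z ^+ 2).
Proof. by move=> cf z hz; apply: (cM (f := f) (g := f)); exact: cf. Qed.

Lemma contH_1 : contH (fun z => z.1).
Proof. by move=> z _; exact: cvg_fst. Qed.

Lemma contH_2 : contH (fun z => z.2).
Proof. by move=> z _; exact: cvg_snd. Qed.

Lemma contH_line u (x0 : R) : contH u -> contH (fun z => u (x0, z.2)).
Proof.
move=> cu z hz; apply: (@continuous_comp _ _ _ snd (fun t => u (x0, t))).
  exact: cvg_snd.
exact: contH_sy.
Qed.

Lemma contH_chi r : r != 0 -> continuous (chi r).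
Proof. by move=> r0 t; exact: is_derive_continuous (d_chi t r0). Qed.

Lemma contH_chi1 r : r != 0 -> continuous (chi1 r).
Proof. by move=> r0 t; exact: is_derive_continuous (d_chi1 t r0). Qed.

Lemma contH_chi2 r : continuous (chi2 r).
Proof.
by move=> t; notypeclasses refine (is_derive_continuous _); rewrite /chi2; der.
Qed.

(** The segment is split at [x0], where the deviation of [u] vanishes. On each half the weight
    [x - m] vanishes at the outer end, [m = - r] or [m = r], so no boundary term is left. The
    distance to [m] is at most [2 r], whence [4 (2 r)^2 = 16 r^2]. *)
Lemma hardy_horizontal u ux x0 r dl : pdx u ux -> contH u -> contH ux ->
  0 <= x0 <= 1 -> 1 <= r -> 0 < dl ->
  boxint r dl (fun z => (u z - u (x0, z.2)) ^+ 2) <=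
  16 * r ^+ 2 * boxint r dl (fun z => ux z ^+ 2).
Proof.
move=> du cu cux /andP[x00 x01] r1 dl0; have r0 : 0 < r by lra.
have ce : contH (fun z => (u z - u (x0, z.2)) ^+ 2).
  by apply: contH_X; apply: contH_B => //; exact: contH_line.
have cx2 := contH_X cux.
have c16 : contH (fun z => 16 * r ^+ 2 * ux z ^+ 2).
  by apply: contH_M => //; exact: contH_C.
rewrite -boxint_Z//; apply: J_le.
- exact: (contI_boxint r0 dl0 ce).
- exact: (contI_boxint r0 dl0 c16).
move=> y /andP[dy _]; have y0 : 0 < y by exact: lt_le_trans dy.
have dux x : is_derive x 1 (fun x => u (x, y) - u (x0, y)) (ux (x, y)).
  by have h := du x y y0; notypeclasses refine (is_derive_cast _ _); [der|rewrite /=; ring].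
have cxx x : {for x, continuous (fun x => ux (x, y))} by exact: contH_sx.
have c1 c d : contI c d (fun x => (u (x, y) - u (x0, y)) ^+ 2).
  exact: (contH_Ix (f := fun z => (u z - u (x0, z.2)) ^+ 2)).
have c2 c d : contI c d (fun x => ux (x, y) ^+ 2).
  exact: (contH_Ix (f := fun z => ux z ^+ 2)).
rewrite /= JZ// (@J_split _ _ _ x0)//; last by apply/andP; split; lra.
rewrite (@J_split _ _ _ x0 (fun x => ux (x, y) ^+ 2))//; last by apply/andP; split; lra.
rewrite mulrDr; apply: lerD.
- have := @hardy R _ _ (- r) x0 (- r) 0 (2 * r) _ dux cxx.
  have E : 4 * (2 * r) ^+ 2 = 16 * r ^+ 2 by ring.
  rewrite mulr0 add0r E; apply; first by lra.
    by rewrite subrr expr0n /= mulr0 subrr mul0r subrr.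
  by move=> x /andP[x1 x2]; rewrite ler_norml; apply/andP; split; lra.
- have := @hardy R _ _ x0 r r 0 (2 * r) _ dux cxx.
  have E : 4 * (2 * r) ^+ 2 = 16 * r ^+ 2 by ring.
  rewrite mulr0 add0r E; apply; first by lra.
    by rewrite !subrr expr0n /= mulr0 mul0r subrr.
  by move=> x /andP[x1 x2]; rewrite ler_norml; apply/andP; split; lra.
Qed.

(** The same argument in [y], with the weight [y - r] vanishing on the top edge. On the bottom edge
    [v] is only at most 1 in absolute value, which leaves the term [4 r^2]. *)
Lemma hardy_normal v vy r dl : pdy v vy -> contH v -> contH vy ->
  0 < dl <= r -> (forall x, `|x| <= r -> `|v (x, dl)| <= 1) ->
  boxint r dl (fun z => v z ^+ 2) <=
  4 * r ^+ 2 + 4 * r ^+ 2 * boxint r dl (fun z => vy z ^+ 2).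
Proof.
move=> dv cv cvy /andP[dl0 dlr] v1; have r0 : 0 < r by lra.
have cX := contH_X cv; have cXy := contH_X cvy.
pose Y z := (z.2 - r) * v z ^+ 2.
pose S z := v z ^+ 2 + 2 * (z.2 - r) * (v z * vy z).
have cs : contH (fun z => z.2 - r) by apply: contH_B; [exact: contH_2|exact: contH_C].
have cY : contH Y by apply: contH_M.
have cS : contH S.
  apply: contH_D => //; apply: contH_M; last exact: contH_M.
  by apply: contH_M => //; exact: contH_C.
have dY : pdy Y S.
  move=> x y y0; rewrite /Y /S /=; have h := dv x y y0.
  by notypeclasses refine (is_derive_cast _ _); [der|rewrite /=; ring].
have E : boxint r dl S = (r - dl) * J (- r) r (fun x => v (x, dl) ^+ 2).
  have -> : boxint r dl S = J (- r) r (fun x => Y (x, r)) - J (- r) r (fun x => Y (x, dl)).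
    apply: boxint_flux => // y y0.
    have -> : J (- r) r (fun x => S (x, y)) = J (- r) r (fun x => 0 + S (x, y)).
      by apply: J_eq => x _; rewrite add0r.
    apply: (@is_derive_divergence R (fun=> 0) Y (fun=> 0)) => //; first by lra.
      by move=> *; exact: dC.
    exact: contH_C.
  have -> : J (- r) r (fun x => Y (x, r)) = 0.
    rewrite (@J_eq _ _ _ _ (fun=> 0)); first by rewrite J_cst ?mul0r//; lra.
    by move=> x _; rewrite /Y /= subrr mul0r.
  rewrite /Y /= JZ; last exact: (contH_Ix (f := fun z => v z ^+ 2)).
  by ring.
have JN : J (- r) r (fun x => v (x, dl) ^+ 2) <= 2 * r.
  have rr : - r <= r by lra.
  have -> : 2 * r = J (- r) r (fun=> 1) by rewrite J_cst//; ring.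
  apply: J_le.
  - exact: (contH_Ix (f := fun z => v z ^+ 2)).
  - by move=> x _; exact: cC.
  - move=> x; rewrite -ler_norml => /v1 h.
    by rewrite -real_normK ?num_real// expr_le1.
have h : boxint r dl (fun z => v z ^+ 2 + (- (4 * r ^+ 2)) * vy z ^+ 2) <=
    boxint r dl (fun z => 2 * S z).
  apply: boxint_le => //.
  - by apply: contH_D => //; apply: contH_M => //; exact: contH_C.
  - by apply: contH_M => //; exact: contH_C.
  move=> x y _ /andP[y1 y2]; rewrite /S /=.
  have h2 : (y - r) ^+ 2 * vy (x, y) ^+ 2 <= r ^+ 2 * vy (x, y) ^+ 2.
    rewrite ler_wpM2r ?sqr_ge0// -[leLHS]real_normK ?num_real//.
    by rewrite ler_pXn2r ?nnegrE ?(ltW r0)// ler_norml; apply/andP; split; lra.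
  have := sqr_ge0 (v (x, y) + 2 * (y - r) * vy (x, y)).
  have -> : (v (x, y) + 2 * (y - r) * vy (x, y)) ^+ 2 = v (x, y) ^+ 2 +
    4 * (y - r) * (v (x, y) * vy (x, y)) + 4 * ((y - r) ^+ 2 * vy (x, y) ^+ 2).
    by ring.
  lra.
move: h; rewrite boxint_D//; last by apply: contH_M => //; exact: contH_C.
rewrite !boxint_Z// E => h.
have h' : (r - dl) * J (- r) r (fun x => v (x, dl) ^+ 2) <= r * (2 * r).
  apply: ler_pM JN; [by rewrite subr_ge0| |by rewrite gerBl ltW].
  by apply: J_ge0 => x _; exact: sqr_ge0.
move: h h'; move: (boxint _ _ _) (boxint _ _ _) (J _ _ _) => A B N.
by clear; lra.
Qed.

(** On [y = 0] the second factor is 1: the cut-off acts on the sides and the top only, and the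
    bottom flux is left to the boundary conditions. *)
Definition eta r z : R := chi r z.1 * chi r z.2.

Lemma contH_eta r : r != 0 -> contH (eta r).
Proof.
move=> r0; apply: contH_M.
  by apply: contH_fst; exact: contH_chi.
by apply: contH_snd; exact: contH_chi.
Qed.

Lemma boxint_ge_box f r dl (x1 y1 s m : R) : contH f -> 0 < dl -> 0 < s ->
  dl <= y1 - s -> y1 + s <= r -> `|x1| + s <= r ->
  (forall x y, `|x| <= r -> dl <= y <= r -> 0 <= f (x, y)) ->
  (forall x y, `|x - x1| <= s -> `|y - y1| <= s -> m <= f (x, y)) ->
  m * (2 * s) * (2 * s) <= boxint r dl f.
Proof.
move=> cf dl0 s0 dly yr xr f0 fm.
have /andP[xa xb] : - `|x1| <= x1 <= `|x1| by rewrite -ler_norml.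
have nx := normr_ge0 x1; have r0 : 0 < r by lra.
have ys : y1 - s <= y1 + s by lra.
have xs : x1 - s <= x1 + s by lra.
have cJ := contI_boxint r0 dl0 cf.
have y2s : y1 + s - (y1 - s) = 2 * s by ring.
have x2s : x1 + s - (x1 - s) = 2 * s by ring.
apply: (@le_trans _ _ (J (y1 - s) (y1 + s) (fun y => J (- r) r (fun x => f (x, y))))); last first.
  apply: J_sub => // y yr'; apply: J_ge0 => x; rewrite -ler_norml => xr'.
  exact: f0.
rewrite -[X in _ * X <= _]y2s -J_cst//; apply: J_le; first by move=> y _; exact: cC.
  exact: contI_sub cJ.
move=> y /andP[ya yb]; have y0 : 0 < y by lra.
have xl : - r <= x1 - s by lra.
have xr' : x1 + s <= r by lra.
have cfx c d : contI c d (fun x => f (x, y)) by exact: contH_Ix.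
apply: (@le_trans _ _ (J (x1 - s) (x1 + s) (fun x => f (x, y)))); last first.
  apply: J_sub => // x; rewrite -ler_norml => xr''; apply: f0 => //.
  by apply/andP; split; lra.
rewrite -[X in _ * X <= _]x2s -J_cst//; apply: J_le => //; first by move=> x _; exact: cC.
move=> x /andP[x_a x_b]; clear -x_a x_b ya yb fm.
by apply: fm; rewrite ler_norml; apply/andP; split; lra.
Qed.

(** A positive value of [q] persists, up to a factor 2, on a small square; once [r] is large the
    cut-off is at least [1 / 4] there, and the integrals stay away from 0. *)
Lemma eq0_of_cutoff_integrals (q : R * R -> R) : contH q -> (forall z, half_plane z -> 0 <= q z) ->
  (forall e : R, 0 < e -> exists2 r0, 1 <= r0 & forall r, r0 <= r ->
    exists2 d0, 0 < d0 & forall dl, 0 < dl < d0 -> dl < r ->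
      boxint r dl (fun z => q z * eta r z) <= e) ->
  forall z, half_plane z -> q z = 0.
Proof.
move=> cq q0 H [x1 y1] y10; apply/eqP/negPn/negP => qn0.
have y1p : 0 < y1 by exact: y10.
have qp : 0 < q (x1, y1) by rewrite lt_neqAle eq_sym qn0 q0.
have qp2 : 0 < q (x1, y1) / 2 by rewrite divr_gt0.
have := cq (x1, y1) y10 => /cvgrPdist_le /(_ _ qp2).
move=> [[A B] /= [[s1 /= s10 sA] [s2 /= s20 sB]] AB].
pose s := Num.min (Num.min s1 s2) y1 / 2.
have m0 : 0 < Num.min (Num.min s1 s2) y1 by rewrite !lt_min s10 s20.
have s0 : 0 < s by rewrite divr_gt0.
have : s < Num.min (Num.min s1 s2) y1 by rewrite ltr_pdivrMr// ltr_pMr// ltr1n.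
rewrite !lt_min => /andP[/andP[ss1 ss2] sy].
have qlow x y : `|x - x1| <= s -> `|y - y1| <= s -> q (x1, y1) / 2 <= q (x, y).
  move=> hx hy; have : `|q (x1, y1) - q (x, y)| <= q (x1, y1) / 2.
    apply: (AB (x, y)); split => /=.
      by apply: sA; rewrite /= distrC; exact: le_lt_trans ss1.
    by apply: sB; rewrite /= distrC; exact: le_lt_trans ss2.
  by rewrite ler_norml => /andP[]; lra.
clear sA sB s10 s20 m0 ss1 ss2 AB qp2 qn0 A B.
(* Half of the lower bound: [q (x1, y1) / 8] times the area [4 s^2] of the square equals [2 e]. *)
pose e := q (x1, y1) * s ^+ 2 / 4.
have e0 : 0 < e by rewrite divr_gt0// mulr_gt0// exprn_gt0.
have [r0 r01 Hr] := H e e0.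
(* The factor 2 places the square in [|x|, |y| <= r / 2], where [chi_half] applies. *)
pose r := r0 + 2 * (`|x1| + s + y1 + s).
have nx := normr_ge0 x1.
have r0r : r0 <= r by rewrite /r; lra.
have rr : 2 * (`|x1| + s + y1 + s) <= r by rewrite /r; lra.
clearbody r; have rp : 0 < r by lra.
have [d0 d00 Hd] := Hr r r0r.
pose dl := Num.min d0 (y1 - s) / 2.
have md : 0 < Num.min d0 (y1 - s) by rewrite lt_min d00 subr_gt0.
have dl0 : 0 < dl by rewrite divr_gt0.
have : dl < Num.min d0 (y1 - s) by rewrite ltr_pdivrMr// ltr_pMr// ltr1n.
rewrite lt_min => /andP[dd ds].
have dlr : dl < r by lra.
have /Hd -/(_ dlr) : 0 < dl < d0 by rewrite dl0.
apply/negP; rewrite -ltNge.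
have rn0 : r != 0 by rewrite gt_eqF.
have cqe : contH (fun z => q z * eta r z) by apply: contH_M => //; exact: contH_eta.
clear H Hr Hd md r0r r01 dd d00; clearbody dl s.
have yr : y1 + s <= r by lra.
have xr : `|x1| + s <= r by lra.
apply: lt_le_trans (boxint_ge_box (m := q (x1, y1) / 8) cqe dl0 s0 (ltW ds) yr xr _ _).
- have -> : q (x1, y1) / 8 * (2 * s) * (2 * s) = 2 * e by rewrite /e; field.
  by rewrite ltr_pMl// ltr1n.
- move=> x y xr' /andP[ya yb]; have y0 : 0 < y by exact: lt_le_trans ya.
  have yr' : `|y| <= r by rewrite gtr0_norm.
  rewrite mulr_ge0 ?q0// /eta /= mulr_ge0//.
    by have /andP[] := chi_01 rp xr'.
  by have /andP[] := chi_01 rp yr'.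
move=> x y hx hy; have hq := qlow x y hx hy.
have xr2 : `|x| <= r / 2.
  clear -hx rr sy y1p s0 nx; have := ler_normD (x - x1) x1; rewrite subrK; lra.
have yr2 : `|y| <= r / 2.
  clear -hy rr sy y1p s0 nx; have := ler_normD (y - y1) y1; rewrite subrK.
  rewrite (gtr0_norm y1p); lra.
have := chi_half rp xr2; have := chi_half rp yr2; rewrite /eta /=.
move: (chi r x) (chi r y) (q (x, y)) (q (x1, y1)) qp hq => cx cy q2 q1.
clear => q10 q12 h1 h2.
have h : 1 / 2 * (1 / 2) <= cx * cy by apply: ler_pM.
have : q1 / 2 * (1 / 2 * (1 / 2)) <= q2 * (cx * cy) by apply: ler_pM => //; lra.
lra.
Qed.

End Estimates.

(** * Truncation of the vorticity and pointwise estimates *)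

Section Truncation.
Variable R : realType.
Implicit Types s x : R.

(* HH is convex with derivatives hh and kk.  It is at most s^2 / 2, which makes
   terms of linear growth integrable, and at most |s|, which leaves room for
   AM-GM against the Hardy-controlled part of the velocity. *)
Definition Sq s : R := Num.sqrt (1 + s ^+ 2).
Definition HH s : R := Sq s - 1.
Definition hh s : R := s / Sq s.
Definition kk s : R := (Sq s ^+ 3)^-1.

Lemma Sq_arg s : 0 < 1 + s ^+ 2.
Proof. by have := sqr_ge0 s; lra. Qed.

Lemma Sq_gt0 s : 0 < Sq s.
Proof. by rewrite sqrtr_gt0 Sq_arg. Qed.

Lemma Sq_sq s : Sq s ^+ 2 = 1 + s ^+ 2.
Proof. by rewrite sqr_sqrtr// ltW// Sq_arg. Qed.

Lemma Sq_ge1 s : 1 <= Sq s.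
Proof. by have := Sq_sq s; have := Sq_gt0 s; have := sqr_ge0 s; nra. Qed.

Lemma Sq_le s : Sq s <= 1 + `|s|.
Proof.
have := Sq_sq s; have := Sq_gt0 s; have := normr_ge0 s.
by rewrite -[s ^+ 2]real_normK ?num_real//; nra.
Qed.

Lemma HH_ge0 s : 0 <= HH s.
Proof. by rewrite /HH; have := Sq_ge1 s; lra. Qed.

Lemma HH_le s : HH s <= `|s|.
Proof. by rewrite /HH; have := Sq_le s; lra. Qed.

Lemma HH_le2 s : HH s <= s ^+ 2 / 2.
Proof.
rewrite /HH; have := Sq_sq s; have := sqr_ge0 (Sq s - 1).
have -> : (Sq s - 1) ^+ 2 = Sq s ^+ 2 - 2 * Sq s + 1 by ring.
lra.
Qed.

Lemma hh_le s : `|hh s| <= `|s|.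
Proof.
rewrite /hh normrM normfV (gtr0_norm (Sq_gt0 s)) ler_pdivrMr ?Sq_gt0//.
by rewrite ler_peMr// Sq_ge1.
Qed.

Lemma kk_gt0 s : 0 < kk s.
Proof. by rewrite invr_gt0 exprn_gt0// Sq_gt0. Qed.

(** The left side is [1 - 1 / Sq s]. It is the primitive of [s * kk s] that vanishes at 0, through
    which the transport term enters the flux; the bound makes it small where the vorticity is. *)
Lemma shh_HH_le s : `|s * hh s - HH s| <= `|s|.
Proof.
have S0 := Sq_gt0 s; have S1 := Sq_ge1 s; have Sl := Sq_le s.
have -> : s * hh s - HH s = (Sq s - 1) / Sq s.
  rewrite /hh /HH; apply: (mulIf (lt0r_neq0 S0)).
  rewrite divfK ?lt0r_neq0// mulrBl -mulrA divfK ?lt0r_neq0//.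
  by rewrite mulrBl -!expr2 Sq_sq mul1r; ring.
have h : 0 <= Sq s - 1 by lra.
rewrite ger0_norm ?divr_ge0 ?(ltW S0)// ler_pdivrMr//.
apply: (@le_trans _ _ `|s|); first by lra.
by rewrite ler_peMr.
Qed.

Lemma d_Sq s : is_derive s 1 Sq (hh s).
Proof.
have h := is_derive1_sqrt (Sq_arg s).
have h2 : is_derive s 1 (fun t => 1 + t ^+ 2) (2 * s).
  by notypeclasses refine (is_derive_cast _ _); [der|rewrite /=; ring].
rewrite /Sq; apply: (is_derive_cast (@d_comp R Num.sqrt (fun t => 1 + t ^+ 2) s _ _ h h2)); rewrite /hh /Sq; field.
by rewrite -/(Sq s) lt0r_neq0// Sq_gt0.
Qed.

Lemma d_HH s : is_derive s 1 HH (hh s).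
Proof.
rewrite /HH; have h := d_Sq s.
by notypeclasses refine (is_derive_cast _ _); [der|rewrite /=; ring].
Qed.

Lemma d_invSq s : is_derive s 1 (fun t => (Sq t)^-1) (- (Sq s) ^- 2 * hh s).
Proof. by apply: is_deriveV; [rewrite lt0r_neq0// Sq_gt0|exact: d_Sq]. Qed.

Lemma d_hh s : is_derive s 1 hh (kk s).
Proof.
rewrite /hh; have h := d_invSq s.
notypeclasses refine (is_derive_cast _ _); [der|rewrite /= /hh /kk].
have S0 : Sq s != 0 by rewrite lt0r_neq0// Sq_gt0.
have E : s ^+ 2 = Sq s ^+ 2 - 1 by rewrite Sq_sq; ring.
have -> : 1 * (Sq s)^-1 + s * (- Sq s ^- 2 * (s / Sq s)) =
  (Sq s ^+ 2 - s ^+ 2) / Sq s ^+ 3 by field.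
by rewrite E; field.
Qed.

Lemma kk_continuous : continuous kk.
Proof.
move=> s; have h := d_invSq s.
have E : kk = (fun t => (Sq t)^-1 * ((Sq t)^-1) ^+ 2).
  by apply/funext => t; rewrite /kk -exprVn exprS.
rewrite E; notypeclasses refine (is_derive_continuous _); der.
Qed.

Lemma hh_continuous : continuous hh.
Proof. by move=> s; exact: is_derive_continuous (d_hh s). Qed.

Lemma HH_continuous : continuous HH.
Proof. by move=> s; exact: is_derive_continuous (d_HH s). Qed.

(** The difference is [(k p - 2 q)^2 / k]. The small factor [k] goes to the quantity controlled by
    Hardy's inequality, the large factor [4 / k] to the one with a vanishing weight. *)
Lemma amgm (k p q : R) : 0 < k -> 4 * p * q <= k * p ^+ 2 + 4 / k * q ^+ 2.
Proof.
move=> k0; have := sqr_ge0 (k * p - 2 * q) => h.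
rewrite -subr_ge0 (_ : _ - _ = (k * p - 2 * q) ^+ 2 / k); last first.
  by field; rewrite lt0r_neq0.
by rewrite divr_ge0// ltW.
Qed.

(** Here [e] stands for the deviation of [u] from its values on the vertical line, [A] for those
    values plus [a y], [H] for [HH w], and [L], [ex], [ey] for the Laplacian and the gradient of the
    cut-off. Products with [e] and [v] use [H <= |w|] and [amgm]. The other terms use
    [H <= w^2 / 2], since their coefficients are already at most a constant times the weight
    [(1 + |x| + y) / r]. *)
Lemma drift_bound (x y r e v A w H L ex ey b c k : R) :
  1 <= r -> `|x| <= r -> 0 < y <= r -> 0 < k -> 0 <= c ->
  0 <= H -> H <= w ^+ 2 / 2 -> H <= `|w| ->
  `|ex| <= 4 * `|x| / r ^+ 2 -> `|ey| <= 4 * y / r ^+ 2 -> `|L| <= 16 / r ^+ 2 ->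
  `|A| <= c * (1 + y) ->
  H * (L + (e + A) * ex + (v + b) * ey) <= k / r ^+ 2 * (e ^+ 2 + v ^+ 2) +
    (4 / k + 4 * c + 2 * `|b| + 8) * (w ^+ 2 * ((1 + `|x| + y) / r)).
Proof.
move=> r1 xr /andP[y0 yr] k0 c0 H0 H2 H1 hex hey hL hA.
have r0 : 0 < r by lra.
have rn0 : r != 0 by rewrite gt_eqF.
set i := r^-1; have i0 : 0 < i by rewrite invr_gt0.
have ri : r * i = 1 by rewrite divff.
have i1 : i <= 1 by rewrite invf_le1.
set X := `|x| in xr hex *; have X0 : 0 <= X by exact: normr_ge0.
have Xi : X * i <= 1 by rewrite -ri ler_pM2r.
have yi : y * i <= 1 by rewrite -ri ler_pM2r.
have yi0 : 0 < y * i by rewrite mulr_gt0.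
have Xi0 : 0 <= X * i by rewrite mulr_ge0// ltW.
have w2 : `|w| ^+ 2 = w ^+ 2 by rewrite real_normK ?num_real.
have e2 : `|e| ^+ 2 = e ^+ 2 by rewrite real_normK ?num_real.
have v2 : `|v| ^+ 2 = v ^+ 2 by rewrite real_normK ?num_real.
have E2 : (r ^+ 2)^-1 = i ^+ 2 by rewrite exprVn.
rewrite E2 -/i in hex hey hL *.
set tau := (1 + X + y) * i.
have tX : X * i <= tau by rewrite /tau -ler_pdivlMr ?mulfK ?gt_eqF//; lra.
have ty : y * i <= tau by rewrite /tau -ler_pdivlMr ?mulfK ?gt_eqF//; lra.
have ti : i <= tau by rewrite /tau ler_peMl// ?ltW//; lra.
have t0 : 0 <= tau by lra.
have W0 := sqr_ge0 w.
(* AM-GM for the terms with [e] and [v] *)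
have T1 : H * (e * ex) <= k * i ^+ 2 * e ^+ 2 + 4 / k * (w ^+ 2 * ((X * i) ^+ 2)).
  have h1 : H * (e * ex) <= `|w| * (`|e| * (4 * X * i ^+ 2)).
    apply: (@le_trans _ _ (H * (`|e| * `|ex|))).
      by rewrite ler_wpM2l// -normrM ler_norm.
    by apply: ler_pM => //; rewrite ler_wpM2l.
  have h2 := amgm (`|e| * i) (`|w| * (X * i)) k0.
  apply: (le_trans h1); rewrite -e2 -w2.
  have -> : `|w| * (`|e| * (4 * X * i ^+ 2)) = 4 * (`|e| * i) * (`|w| * (X * i)) by ring.
  by apply: (le_trans h2); rewrite !exprMn; lra.
have T2 : H * (v * ey) <= k * i ^+ 2 * v ^+ 2 + 4 / k * (w ^+ 2 * ((y * i) ^+ 2)).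
  have h1 : H * (v * ey) <= `|w| * (`|v| * (4 * y * i ^+ 2)).
    apply: (@le_trans _ _ (H * (`|v| * `|ey|))).
      by rewrite ler_wpM2l// -normrM ler_norm.
    by apply: ler_pM => //; rewrite ler_wpM2l.
  have h2 := amgm (`|v| * i) (`|w| * (y * i)) k0.
  apply: (le_trans h1); rewrite -v2 -w2.
  have -> : `|w| * (`|v| * (4 * y * i ^+ 2)) = 4 * (`|v| * i) * (`|w| * (y * i)) by ring.
  by apply: (le_trans h2); rewrite !exprMn; lra.
have T12 : (X * i) ^+ 2 + (y * i) ^+ 2 <= tau.
  have : (X * i) ^+ 2 <= X * i by rewrite expr2 ler_piMr.
  have : (y * i) ^+ 2 <= y * i by rewrite expr2 ler_piMr// ltW.
  rewrite /tau => h1 h2; have -> : (1 + X + y) * i = i + X * i + y * i by ring.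
  lra.
have K0 : 0 < 4 / k by rewrite divr_gt0.
have T12' : 4 / k * (w ^+ 2 * ((X * i) ^+ 2)) + 4 / k * (w ^+ 2 * ((y * i) ^+ 2)) <=
    4 / k * (w ^+ 2 * tau).
  by rewrite -mulrDr -mulrDr ler_pM2l// ler_wpM2l.
have T3 : H * (A * ex) <= 4 * c * (w ^+ 2 * tau).
  (* The linear growth of [A] is absorbed by one factor [1 / r]; the other leaves [|x| / r], which
     the weight dominates. *)
  have y2 : (1 + y) * i <= 2 by rewrite -ler_pdivlMr// invrK; lra.
  have h1 : A * ex <= 8 * c * (X * i).
    apply: le_trans (ler_norm _) _; rewrite normrM.
    apply: (@le_trans _ _ (c * (1 + y) * (4 * X * i ^+ 2))); first exact: ler_pM.
    have -> : c * (1 + y) * (4 * X * i ^+ 2) = 4 * (c * (X * i)) * ((1 + y) * i) by ring.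
    have -> : 8 * c * (X * i) = 4 * (c * (X * i)) * 2 by ring.
    by rewrite ler_wpM2l// mulr_ge0// mulr_ge0.
  apply: (@le_trans _ _ (H * (8 * c * tau))).
    by rewrite ler_wpM2l//; apply: (le_trans h1); rewrite ler_wpM2l// mulr_ge0.
  apply: (@le_trans _ _ (w ^+ 2 / 2 * (8 * c * tau))).
    by apply: ler_wpM2r => //; rewrite mulr_ge0 // mulr_ge0.
  by rewrite le_eqVlt; apply/orP; left; apply/eqP; field.
have T4 : H * (b * ey) <= 2 * `|b| * (w ^+ 2 * tau).
  have h1 : b * ey <= 4 * `|b| * tau.
    apply: le_trans (ler_norm _) _; rewrite normrM.
    apply: (@le_trans _ _ (`|b| * (4 * y * i ^+ 2))); first by rewrite ler_wpM2l.
    have -> : `|b| * (4 * y * i ^+ 2) = 4 * `|b| * ((y * i) * i) by ring.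
    apply: ler_wpM2l; first exact: mulr_ge0.
    apply: le_trans ty.
    by rewrite ler_piMr// ltW.
  apply: (@le_trans _ _ (w ^+ 2 / 2 * (4 * `|b| * tau))).
    apply: (@le_trans _ _ (H * (4 * `|b| * tau))); first by rewrite ler_wpM2l.
    by apply: ler_wpM2r => //; rewrite mulr_ge0 // mulr_ge0.
  by rewrite le_eqVlt; apply/orP; left; apply/eqP; field.
have T5 : H * L <= 8 * (w ^+ 2 * tau).
  have h1 : L <= 16 * tau.
    apply: le_trans (ler_norm _) _; apply: (le_trans hL).
    rewrite ler_wpM2l//; apply: le_trans ti.
    by rewrite expr2 ler_piMr// ltW.
  apply: (@le_trans _ _ (w ^+ 2 / 2 * (16 * tau))).
    apply: (@le_trans _ _ (H * (16 * tau))); first by rewrite ler_wpM2l.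
    by apply: ler_wpM2r => //; rewrite mulr_ge0.
  by rewrite le_eqVlt; apply/orP; left; apply/eqP; field.
have -> : H * (L + (e + A) * ex + (v + b) * ey) =
  H * L + H * (e * ex) + H * (A * ex) + H * (v * ey) + H * (b * ey) by ring.
have -> : (4 / k + 4 * c + 2 * `|b| + 8) * (w ^+ 2 * tau) =
  4 / k * (w ^+ 2 * tau) + 4 * c * (w ^+ 2 * tau) + 2 * `|b| * (w ^+ 2 * tau)
  + 8 * (w ^+ 2 * tau) by ring.
lra.
Qed.

(** The counterpart of [drift_bound] for the second test, with a right side of the shape that
    [cutoff_error_bound] integrates. As [v] occurs in both products, each gets [k / 2], which turns
    [4 / k] into [8 / k]. *)
Lemma gradient_bound (x y r e v vx vy ex ey k : R) :
  1 <= r -> `|x| <= r -> 0 < y <= r -> 0 < k ->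
  `|ex| <= 4 * `|x| / r ^+ 2 -> `|ey| <= 4 * y / r ^+ 2 ->
  - (v * (vx * ex + vy * ey)) <= k / r ^+ 2 * (e ^+ 2 + v ^+ 2) +
    8 / k * ((vx ^+ 2 + vy ^+ 2) * ((1 + `|x| + y) / r)).
Proof.
move=> r1 xr /andP[y0 yr] k0 hex hey.
have r0 : 0 < r by lra.
have rn0 : r != 0 by rewrite gt_eqF.
set i := r^-1; have i0 : 0 < i by rewrite invr_gt0.
have ri : r * i = 1 by rewrite divff.
have E2 : (r ^+ 2)^-1 = i ^+ 2 by rewrite exprVn.
have K0 : 0 < 8 / k by rewrite divr_gt0.
have k2 : 0 < k / 2 by rewrite divr_gt0.
have kk8 : 4 / (k / 2) = 8 / k by field; rewrite gt_eqF.
have T p q ee s : 0 <= s -> s * i <= 1 -> `|ee| <= 4 * s / r ^+ 2 ->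
    - (p * (q * ee)) <= k / 2 * (p * i) ^+ 2 + 8 / k * (q ^+ 2 * (s * i)).
  rewrite E2 => s0 si hee; have si0 : 0 <= s * i by rewrite mulr_ge0// ltW.
  apply: (@le_trans _ _ (4 * (`|p| * i) * (`|q| * (s * i)))).
    apply: (le_trans (ler_norm _)); rewrite normrN !normrM.
    have -> : 4 * (`|p| * i) * (`|q| * (s * i)) = `|p| * (`|q| * (4 * s * i ^+ 2)) by ring.
    by apply: ler_wpM2l => //; apply: ler_wpM2l.
  have h := amgm (`|p| * i) (`|q| * (s * i)) k2; rewrite kk8 in h.
  apply: (le_trans h); rewrite !exprMn !real_normK ?num_real// lerD2l.
  apply: ler_wpM2l; first exact: ltW.
  rewrite -exprMn; apply: ler_wpM2l; first exact: sqr_ge0.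
  by rewrite expr2 ler_piMr.
have Xi : `|x| * i <= 1 by rewrite -ri ler_pM2r.
have yi : y * i <= 1 by rewrite -ri ler_pM2r.
have h1 := T v vx ex _ (normr_ge0 x) Xi hex.
have h2 := T v vy ey _ (ltW y0) yi hey.
have g1 : vx ^+ 2 * (`|x| * i) <= vx ^+ 2 * ((1 + `|x| + y) * i).
  apply: ler_wpM2l; first exact: sqr_ge0.
  by rewrite ler_pM2r//; lra.
have g2 : vy ^+ 2 * (y * i) <= vy ^+ 2 * ((1 + `|x| + y) * i).
  apply: ler_wpM2l; first exact: sqr_ge0.
  by rewrite ler_pM2r//; have := normr_ge0 x; lra.
have g3 : 8 / k * (vx ^+ 2 * (`|x| * i) + vy ^+ 2 * (y * i)) <=
    8 / k * ((vx ^+ 2 + vy ^+ 2) * ((1 + `|x| + y) * i)).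
  by rewrite ler_pM2l// mulrDl; exact: lerD.
have g4 : 0 <= k * i ^+ 2 * e ^+ 2.
  by rewrite mulr_ge0 ?sqr_ge0// mulr_ge0 ?sqr_ge0// ltW.
rewrite E2; apply: le_trans (lerD (lexx _) g3).
have -> : - (v * (vx * ex + vy * ey)) = - (v * (vx * ex)) - v * (vy * ey) by ring.
apply: (le_trans (lerD h1 h2)).
have -> : k * i ^+ 2 * (e ^+ 2 + v ^+ 2) = k * i ^+ 2 * e ^+ 2 + k * (v * i) ^+ 2 by ring.
clear -g4; move: g4; rewrite mulrDr; lra.
Qed.

End Truncation.

Ltac contH := lazymatch goal with
  | |- contH (fun z => z.1) => exact (@contH_1 _)
  | |- contH (fun z => z.2) => exact (@contH_2 _)
  | |- contH (fun z => @?f z + - @?g z) => refine (contH_B (f := f) (g := g) _ _); contH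
  | |- contH (fun z => @?f z + @?g z) => refine (contH_D (f := f) (g := g) _ _); contH
  | |- contH (fun z => @?f z * @?g z) => refine (contH_M (f := f) (g := g) _ _); contH
  | |- contH (fun z => - @?f z) => refine (contH_N (f := f) _); contH
  | |- contH (fun z => @?f z ^+ 2) => refine (contH_X (f := f) _); contH
  | _ => first
    [ match goal with
        H : contH ?h |- contH (fun z => ?f z) => constr_eq h f; exact H end
    | match goal with H : contH ?h |- contH ?f => constr_eq h f; exact H end
    | exact (@contH_C _ _) | assumption ]
  end.

(** * The cut-off function *)

Section CutOff.
Variable R : realType.
Implicit Types (x y r dl k e : R) (f g u v : R * R -> R) (z : R * R).

Definition etax r z : R := chi1 r z.1 * chi r z.2.
Definition etay r z : R := chi r z.1 * chi1 r z.2.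
Definition lap_eta r z : R := chi2 r z.1 * chi r z.2 + chi r z.1 * chi2 r z.2.

Lemma eta_pdx r : r != 0 -> pdx (eta r) (etax r).
Proof.
move=> r0 x y _; rewrite /eta /etax /=; have h := d_chi x r0.
by notypeclasses refine (is_derive_cast _ _); [der|rewrite /=; ring].
Qed.

Lemma eta_pdy r : r != 0 -> pdy (eta r) (etay r).
Proof.
move=> r0 x y _; rewrite /eta /etay /=; have h := d_chi y r0.
by notypeclasses refine (is_derive_cast _ _); [der|rewrite /=; ring].
Qed.

Lemma etax_pdx r : r != 0 -> pdx (etax r) (fun z => chi2 r z.1 * chi r z.2).
Proof.
move=> r0 x y _; rewrite /etax /=; have h := d_chi1 x r0.
by notypeclasses refine (is_derive_cast _ _); [der|rewrite /=; ring].
Qed.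

Lemma etay_pdy r : r != 0 -> pdy (etay r) (fun z => chi r z.1 * chi2 r z.2).
Proof.
move=> r0 x y _; rewrite /etay /=; have h := d_chi1 y r0.
by notypeclasses refine (is_derive_cast _ _); [der|rewrite /=; ring].
Qed.

Lemma contH_etax r : r != 0 -> contH (etax r).
Proof.
move=> r0; apply: contH_M.
  by apply: contH_fst; exact: contH_chi1.
by apply: contH_snd; exact: contH_chi.
Qed.

Lemma contH_etay r : r != 0 -> contH (etay r).
Proof.
move=> r0; apply: contH_M.
  by apply: contH_fst; exact: contH_chi.
by apply: contH_snd; exact: contH_chi1.
Qed.

Lemma eta_01 r x y : 0 < r -> `|x| <= r -> 0 < y <= r -> 0 <= eta r (x, y) <= 1.
Proof.
move=> r0 xr /andP[y0 yr]; have yr' : `|y| <= r by rewrite gtr0_norm.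
have /andP[a1 a2] := chi_01 r0 xr; have /andP[b1 b2] := chi_01 r0 yr'.
by rewrite /eta /= mulr_ge0//= mulr_ile1.
Qed.

Lemma etax_le r x y : 0 < r -> `|x| <= r -> 0 < y <= r ->
  `|etax r (x, y)| <= 4 * `|x| / r ^+ 2.
Proof.
move=> r0 xr /andP[y0 yr]; have yr' : `|y| <= r by rewrite gtr0_norm.
have /andP[b1 b2] := chi_01 r0 yr'; have h := chi1_le r0 xr.
rewrite /etax /= normrM (ger0_norm b1); apply: le_trans h.
by rewrite ler_piMr.
Qed.

Lemma etay_le r x y : 0 < r -> `|x| <= r -> 0 < y <= r ->
  `|etay r (x, y)| <= 4 * y / r ^+ 2.
Proof.
move=> r0 xr /andP[y0 yr]; have yr' : `|y| <= r by rewrite gtr0_norm.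
have /andP[b1 b2] := chi_01 r0 xr; have h := chi1_le r0 yr'.
rewrite /etay /= normrM (ger0_norm b1) -[y in leRHS](gtr0_norm y0).
by apply: le_trans h; rewrite ler_piMl.
Qed.

Lemma lap_eta_le r x y : 0 < r -> `|x| <= r -> 0 < y <= r ->
  `|lap_eta r (x, y)| <= 16 / r ^+ 2.
Proof.
move=> r0 xr /andP[y0 yr]; have yr' : `|y| <= r by rewrite gtr0_norm.
have /andP[a1 a2] := chi_01 r0 xr; have /andP[b1 b2] := chi_01 r0 yr'.
have h1 := chi2_le r0 xr; have h2 := chi2_le r0 yr'.
have -> : 16 / r ^+ 2 = 8 / r ^+ 2 + 8 / r ^+ 2 by rewrite -mulrDl; congr (_ / _); ring.
apply: le_trans (ler_normD _ _) _; apply: lerD; rewrite normrM /=.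
  by rewrite (ger0_norm b1); apply: le_trans h1; rewrite ler_piMr.
by rewrite (ger0_norm a1); apply: le_trans h2; rewrite ler_piMl.
Qed.

(** The weight of [dirichlet_weighted_tail]. *)
Definition wt r z : R := (1 + `|z.1| + z.2) / r.

Lemma contH_wt r : contH (wt r).
Proof.
apply: contH_M; last exact: contH_C.
apply: contH_D; last exact: contH_2.
apply: contH_D; first exact: contH_C.
by apply: contH_comp; [exact: norm_continuous|exact: contH_1].
Qed.

(** The factors [r^2] of the Hardy inequalities cancel [1 / r^2] and leave [16 D + (4 + 4 D)]. The
    weighted term is below [e] for large [r], with [r0] chosen after [k] and [C]; only [d0], which
    ensures [|v| <= 1] on the bottom edge, depends on [r]. *)
Lemma cutoff_error_bound u ux v vy g x0 D :
  pdx u ux -> pdy v vy -> contH u -> contH ux -> contH v -> contH vy ->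
  contH g -> (forall z, half_plane z -> 0 <= g z) ->
  (forall z, half_plane z -> ux z ^+ 2 <= g z) ->
  (forall z, half_plane z -> vy z ^+ 2 <= g z) ->
  (forall r e, 0 < e -> exists2 d0 : R, 0 < d0 &
     forall x y, `|x| <= r -> 0 < y < d0 -> `|v (x, y)| <= e) ->
  (\int[(@lebesgue_measure R) \x (@lebesgue_measure R)]_(z in @half_plane R)
     (g z)%:E < +oo)%E ->
  0 <= x0 <= 1 -> (forall r dl, 0 < r -> 0 < dl -> boxint r dl g <= D) ->
  forall k C e : R, 0 < k -> 0 <= C -> 0 < e ->
  exists2 r0 : R, 1 <= r0 & forall r, r0 <= r -> exists2 d0 : R, 0 < d0 &
    forall dl, 0 < dl < d0 -> dl < r ->
    boxint r dl (fun z => k / r ^+ 2 * ((u z - u (x0, z.2)) ^+ 2 + v z ^+ 2) +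
      C * (g z * wt r z)) <= k * (20 * D + 4) + e.
Proof.
move=> du dv cu cux cv cvy cg g0 uxg vyg bv goo x01 gD k C e k0 C0 e0.
have C1 : 0 < C + 1 by lra.
have eC : 0 < e / (C + 1) by rewrite divr_gt0.
have CC : C * (e / (C + 1)) <= e.
  by rewrite mulrA ler_pdivrMr// mulrC ler_pM2l// lerDl.
have [r0 r01 Hr] := dirichlet_weighted_tail cg g0 goo eC.
exists r0 => // r r0r; have [d0 d00 Hd] := bv r 1 ltr01.
have r1 : 1 <= r by exact: le_trans r0r.
have rp : 0 < r by lra.
exists d0 => // dl /andP[dl0 dld] dlr.
have cwt := contH_wt (r := r).
have cul := contH_line (x0 := x0) cu.
have h1 : boxint r dl (fun z => (u z - u (x0, z.2)) ^+ 2) <= 16 * r ^+ 2 * D.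
  apply: (le_trans (hardy_horizontal du cu cux x01 r1 dl0)).
  apply: ler_wpM2l; first by rewrite mulr_ge0 ?sqr_ge0.
  apply: le_trans (gD r dl rp dl0).
  apply: boxint_le => //; first by contH.
  by move=> x y _ /andP[ya _]; apply: uxg; exact: lt_le_trans ya.
have h2 : boxint r dl (fun z => v z ^+ 2) <= 4 * r ^+ 2 + 4 * r ^+ 2 * D.
  have dlr' : 0 < dl <= r by rewrite dl0 ltW.
  have v1 x : `|x| <= r -> `|v (x, dl)| <= 1 by move=> xr; apply: Hd; rewrite ?dl0.
  apply: (le_trans (hardy_normal dv cv cvy dlr' v1)).
  rewrite lerD2l; apply: ler_wpM2l; first by rewrite mulr_ge0 ?sqr_ge0.
  apply: le_trans (gD r dl rp dl0).
  apply: boxint_le => //; first by contH.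
  by move=> x y _ /andP[ya _]; apply: vyg; exact: lt_le_trans ya.
have h3 : boxint r dl (fun z => g z * wt r z) <= e / (C + 1) by exact: Hr.
rewrite boxint_D//; [|by contH|by contH].
rewrite (boxint_Z (f := fun z => (u z - u (x0, z.2)) ^+ 2 + v z ^+ 2))//; last by contH.
rewrite (boxint_Z (f := fun z => g z * wt r z))//; last by contH.
rewrite boxint_D//; [|by contH|by contH].
apply: lerD.
  apply: (@le_trans _ _ (k / r ^+ 2 * (16 * r ^+ 2 * D + (4 * r ^+ 2 + 4 * r ^+ 2 * D)))).
    rewrite ler_wpM2l//; last exact: lerD.
    by rewrite divr_ge0 ?sqr_ge0// ltW.
  rewrite le_eqVlt; apply/orP; left; apply/eqP; field.
  by rewrite gt_eqF.
by apply: le_trans CC; rewrite ler_wpM2l.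
Qed.

End CutOff.

(** * Growth of [u] along a vertical line *)

Section Growth.
Variable R : realType.
Implicit Types (u uy g : R * R -> R).

(** Integrating [|uy| <= 1 / 2 + uy^2 / 2] from height 1 gives a linear bound. Cauchy-Schwarz would
    give a square root, but [a y] is linear anyway. *)
Lemma linear_growth_on_line u uy g (x0 D0 : R) : pdy u uy -> contH uy -> contH g ->
  (forall z, half_plane z -> uy z ^+ 2 <= g z) ->
  (forall c d, 0 < c -> J c d (fun y => g (x0, y)) <= D0) ->
  exists2 c, 0 <= c & forall y, 0 < y -> `|u (x0, y)| <= c * (1 + y).
Proof.
move=> du cuy cg ug gD.
have H y1 y2 : 0 < y1 -> y1 <= y2 ->
    `|u (x0, y2) - u (x0, y1)| <= (y2 - y1) / 2 + D0 / 2.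
  move=> y10 y12.
  have cuyI : contI y1 y2 (fun y => uy (x0, y)) by exact: contH_Iy.
  have cgI : contI y1 y2 (fun y => g (x0, y)) by exact: contH_Iy.
  have cg2 : contI y1 y2 (fun y => 2^-1 * g (x0, y)).
    by move=> y hy; apply: cM; [exact: cC|exact: cgI].
  have c1 : contI y1 y2 (fun=> 2^-1) by move=> y _; exact: cC.
  have cb : contI y1 y2 (fun y => 2^-1 + 2^-1 * g (x0, y)).
    by move=> y hy; apply: cD; [exact: c1|exact: cg2].
  have E : J y1 y2 (fun y => uy (x0, y)) = u (x0, y2) - u (x0, y1).
    apply: (J_FTC (F := fun y => u (x0, y))) => // y /andP[hy _].
    by apply: du; exact: lt_le_trans hy.
  have B : J y1 y2 (fun y => 2^-1 + 2^-1 * g (x0, y)) <= (y2 - y1) / 2 + D0 / 2.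
    rewrite JD// J_cst// JZ// [leLHS]addrC addrC mulrC.
    by rewrite lerD// [leRHS]mulrC// ler_pM2l// ?gD// invr_gt0.
  have P y : y1 <= y <= y2 -> `|uy (x0, y)| <= 2^-1 + 2^-1 * g (x0, y).
    move=> /andP[hy _]; have y0 : 0 < y by exact: lt_le_trans hy.
    have := ug (x0, y) y0; rewrite -[uy _ ^+ 2]real_normK ?num_real//.
    have := sqr_ge0 (`|uy (x0, y)| - 1).
    move: `|uy (x0, y)| (g (x0, y)) => s q; clear => h1 h2.
    by move: h1 h2; rewrite !expr2; lra.
  rewrite -E ler_norml; apply/andP; split; last first.
    by apply: le_trans B; apply: J_le => // y /P; rewrite ler_norml => /andP[].
  rewrite lerNl -[leLHS]mulN1r -JZ//; apply: le_trans B; apply: J_le => //.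
    by move=> y hy; apply: cM; [exact: cC|exact: cuyI].
  by move=> y /P; rewrite ler_norml mulN1r lerNl => /andP[].
exists (`|u (x0, 1)| + `|D0| + 1).
  by rewrite addr_ge0// addr_ge0.
move=> y y0; have n0 := normr_ge0 (u (x0, 1)); have n1 := ler_norm D0.
have n2 := normr_ge0 D0.
have K : `|u (x0, y) - u (x0, 1)| <= (1 + y) / 2 + D0 / 2.
  have [y1|y1] := leP y 1.
    by rewrite distrC; apply: le_trans (H _ _ y0 y1) _; lra.
  by apply: le_trans (H _ _ ltr01 (ltW y1)) _; lra.
have := ler_normD (u (x0, y) - u (x0, 1)) (u (x0, 1)); rewrite subrK.
move: `|u (x0, y)| `|u (x0, y) - u (x0, 1)| `|u (x0, 1)| `|D0| n0 n1 n2 K => s p q dd.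
clear -y0 => n0 n1 n2 K h.
have : 0 <= q * y by rewrite mulr_ge0// ltW.
have : 0 <= dd * y by rewrite mulr_ge0// ltW.
by lra.
Qed.

Lemma boxint_dirichlet g r dl : contH g -> (forall z, half_plane z -> 0 <= g z) ->
  (\int[(@lebesgue_measure R) \x (@lebesgue_measure R)]_(z in @half_plane R)
     (g z)%:E < +oo)%E -> 0 < r -> 0 < dl ->
  boxint r dl g <= fine (\int[(@lebesgue_measure R) \x (@lebesgue_measure R)]_(z in
    @half_plane R) (g z)%:E)%E.
Proof.
move=> cg g0 goo r0 dl0; have rr : - r <= r by lra.
have I0 : (0 <= \int[(@lebesgue_measure R) \x (@lebesgue_measure R)]_(z in
    @half_plane R) (g z)%:E)%E.
  by apply: integral_ge0 => z hz; rewrite lee_fin g0.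
have If : (\int[(@lebesgue_measure R) \x (@lebesgue_measure R)]_(z in
    @half_plane R) (g z)%:E)%E \is a fin_num by rewrite ge0_fin_numE.
have := @integral_half_plane_ge R g (- r) r dl r cg g0 rr dl0.
by rewrite -{1}(fineK If) lee_fin.
Qed.

End Growth.

(** * Vorticity *)

Section Vorticity.
Variables (R : realType) (a b : R).
Variables (u ux uy v vy w wx wy P Px Py g : R * R -> R).
Hypotheses (du : pdx u ux) (du' : pdy u uy) (dv : pdy v vy).
Hypotheses (dwx : pdx w wx) (dwy : pdy w wy) (dPx : pdx P Px) (dPy : pdy P Py).
Hypotheses (cu : contH u) (cux : contH ux) (cuy : contH uy) (cv : contH v)
  (cvy : contH vy) (cw : contH w) (cwx : contH wx) (cwy : contH wy)
  (cPx : contH Px) (cPy : contH Py).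
Hypothesis div0 : forall z, half_plane z -> ux z + vy z = 0.
(** For a divergence-free field the Laplacian is [(- wy, wx)], and [w - a] is the vorticity of [W].
    So [Px = - wy + (v + b) (w - a) + a b] and [Py = wx - (u + a y) (w - a)]. *)
Hypothesis ePx : forall z, half_plane z ->
  Px z = - wy z + (v z + b) * w z - a * v z.
Hypothesis ePy : forall z, half_plane z ->
  Py z = wx z - (u z + a * z.2) * w z + a * (u z + a * z.2).

Section Flux.
Variable r : R.
Hypothesis r0 : 0 < r.

Let rr : - r <= r.
Proof. by apply: (@le_trans _ _ 0); [rewrite oppr_le0|]; exact: ltW. Qed.
Let rn0 : r != 0. Proof. by rewrite gt_eqF. Qed.
Let cHHw : contH (fun z => HH (w z)).
Proof. by apply: contH_comp => //; exact: HH_continuous. Qed.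
Let chhw : contH (fun z => hh (w z)).
Proof. by apply: contH_comp => //; exact: hh_continuous. Qed.
Let ckkw : contH (fun z => kk (w z)).
Proof. by apply: contH_comp => //; exact: kk_continuous. Qed.
Let ceta := contH_eta rn0.
Let cetax := contH_etax rn0.
Let cetay := contH_etay rn0.
Let cchi_1 : contH (fun z => chi r z.1).
Proof. by apply: contH_fst; exact: contH_chi. Qed.
Let cchi_2 : contH (fun z => chi r z.2).
Proof. by apply: contH_snd; exact: contH_chi. Qed.
Let cchi2_1 : contH (fun z => chi2 r z.1).
Proof. by apply: contH_fst; exact: contH_chi2. Qed.
Let cchi2_2 : contH (fun z => chi2 r z.2).
Proof. by apply: contH_snd; exact: contH_chi2. Qed.

Let phi z := hh (w z) * eta r z.
Let phix z := kk (w z) * wx z * eta r z + hh (w z) * etax r z.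
Let phiy z := kk (w z) * wy z * eta r z + hh (w z) * etay r z.
(** The gradient of [G] is [w * kk w] times that of [w]; as [W] is divergence-free, the transport
    term [w W . grad (hh w)] is the divergence of [G W]. *)
Let G z := w z * hh (w z) - HH (w z).
Let U z := u z + a * z.2.
Let V z := v z + b.

(* [source] is the weak divergence of a field whose second component is [flux]
   and whose first component vanishes at x = r and at x = - r. *)
Definition flux z : R :=
  - (Px z * phi z) + (- a * (v z * phi z) + G z * V z * eta r z - HH (w z) * etay r z).
Definition source z : R :=
  kk (w z) * (wx z ^+ 2 + wy z ^+ 2) * eta r z
  - HH (w z) * (lap_eta r z + U z * etax r z + V z * etay r z).

(** The field [(X, Y)] corrects the weak curl of [grad P] tested with [phi]. Its first term cancels
    the terms in [a]. Its second cancels [w W . grad (hh w) eta] and leaves [G - w hh w = - HH w]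
    times [W . grad eta]. Its third moves the derivative in [hh w grad w . grad eta] onto the
    cut-off. *)
Let X z := - a * (U z * phi z) + G z * U z * eta r z - HH (w z) * etax r z.
Let Xx z := - a * (ux z * phi z + U z * phix z)
  + (w z * (kk (w z) * wx z) * U z + G z * ux z) * eta r z + G z * U z * etax r z
  - (hh (w z) * wx z * etax r z + HH (w z) * (chi2 r z.1 * chi r z.2)).
Let Y z := - a * (v z * phi z) + G z * V z * eta r z - HH (w z) * etay r z.
Let Yy z := - a * (vy z * phi z + v z * phiy z)
  + (w z * (kk (w z) * wy z) * V z + G z * vy z) * eta r z + G z * V z * etay r z
  - (hh (w z) * wy z * etay r z + HH (w z) * (chi r z.1 * chi2 r z.2)).

Let dhh_x (x y : R) : 0 < y ->
  is_derive x 1 (fun t => hh (w (t, y))) (kk (w (x, y)) * wx (x, y)).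
Proof.
move=> y0.
exact: (@d_comp R (@hh R) (fun t => w (t, y)) x _ _ (d_hh (w (x, y))) (dwx x y0)).
Qed.

Let dhh_y (x y : R) : 0 < y ->
  is_derive y 1 (fun t => hh (w (x, t))) (kk (w (x, y)) * wy (x, y)).
Proof.
move=> y0.
exact: (@d_comp R (@hh R) (fun t => w (x, t)) y _ _ (d_hh (w (x, y))) (dwy x y0)).
Qed.

Let dHH_x (x y : R) : 0 < y ->
  is_derive x 1 (fun t => HH (w (t, y))) (hh (w (x, y)) * wx (x, y)).
Proof.
move=> y0.
exact: (@d_comp R (@HH R) (fun t => w (t, y)) x _ _ (d_HH (w (x, y))) (dwx x y0)).
Qed.

Let dHH_y (x y : R) : 0 < y ->
  is_derive y 1 (fun t => HH (w (x, t))) (hh (w (x, y)) * wy (x, y)).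
Proof.
move=> y0.
exact: (@d_comp R (@HH R) (fun t => w (x, t)) y _ _ (d_HH (w (x, y))) (dwy x y0)).
Qed.

Let dphix : pdx phi phix.
Proof.
move=> x y y0; rewrite /phi /phix; have h1 := dhh_x x y0; have h2 := eta_pdx rn0 x y0.
by notypeclasses refine (is_derive_cast _ _); [der|rewrite /=; ring].
Qed.

Let dphiy : pdy phi phiy.
Proof.
move=> x y y0; rewrite /phi /phiy; have h1 := dhh_y x y0; have h2 := eta_pdy rn0 x y0.
by notypeclasses refine (is_derive_cast _ _); [der|rewrite /=; ring].
Qed.

Let dX : pdx X Xx.
Proof.
move=> x y y0; rewrite /X /Xx /G /U /=.
have h1 := dhh_x x y0; have h2 := eta_pdx rn0 x y0; have h3 := dHH_x x y0.
have h4 := etax_pdx rn0 x y0; have h5 := dphix x y0; have h6 := dwx x y0.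
have h7 := du x y0.
by notypeclasses refine (is_derive_cast _ _); [der|rewrite /= /phi /phix; ring].
Qed.

Let dY : pdy Y Yy.
Proof.
move=> x y y0; rewrite /Y /Yy /G /V /=.
have h1 := dhh_y x y0; have h2 := eta_pdy rn0 x y0; have h3 := dHH_y x y0.
have h4 := etay_pdy rn0 x y0; have h5 := dphiy x y0; have h6 := dwy x y0.
have h7 := dv x y0.
by notypeclasses refine (is_derive_cast _ _); [der|rewrite /= /phi /phiy; ring].
Qed.

Let cphi : contH phi. Proof. by rewrite /phi; contH. Qed.
Let cphix : contH phix. Proof. by rewrite /phix; contH. Qed.
Let cphiy : contH phiy. Proof. by rewrite /phiy; contH. Qed.
Let cG : contH G. Proof. by rewrite /G; contH. Qed.
Let cU : contH U. Proof. by rewrite /U; contH. Qed.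
Let cV : contH V. Proof. by rewrite /V; contH. Qed.
Let cXx : contH Xx. Proof. by rewrite /Xx; contH. Qed.
Let cY : contH Y. Proof. by rewrite /Y; contH. Qed.
Let cYy : contH Yy. Proof. by rewrite /Yy; contH. Qed.
Lemma source_contH : contH source.
Proof. by rewrite /source /lap_eta; contH. Qed.

(** The pressure part is differentiated by [is_derive_weak_flux], the correction [(X, Y)] by
    [is_derive_divergence]; with [vy = - ux], the sum of the integrands is [source] pointwise. *)
Lemma flux_derive (y : R) : 0 < y ->
  is_derive y 1 (fun y => J (- r) r (fun x => flux (x, y)))
    (J (- r) r (fun x => source (x, y))).
Proof.
move=> y0.
have eta_l t : eta r (- r, t) = 0 by rewrite /eta /= chi_Nr// mul0r.
have eta_r t : eta r (r, t) = 0 by rewrite /eta /= chi_r// mul0r.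
have etax_l t : etax r (- r, t) = 0 by rewrite /etax /= chi1_Nr// mul0r.
have etax_r t : etax r (r, t) = 0 by rewrite /etax /= chi1_r// mul0r.
have W : is_derive y 1 (fun y => J (- r) r (fun x => Px (x, y) * phi (x, y)))
    (J (- r) r (fun x => Px (x, y) * phiy (x, y) - Py (x, y) * phix (x, y))).
  apply: (is_derive_weak_flux rr y0 dPx dPy cPx cPy dphix dphiy) => // t _.
    by rewrite /phi eta_l mulr0.
  by rewrite /phi eta_r mulr0.
have D : is_derive y 1 (fun y => J (- r) r (fun x => Y (x, y)))
    (J (- r) r (fun x => Xx (x, y) + Yy (x, y))).
  apply: (is_derive_divergence rr y0 dX dY) => // t _; rewrite /X /phi.
    by rewrite eta_l etax_l; ring.
  by rewrite eta_r etax_r; ring.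
have DW := dD (dN W) D.
have cPphi : contH (fun z => Px z * phi z) by contH.
have cS1 : contH (fun z => Px z * phiy z - Py z * phix z) by contH.
have cXY : contH (fun z => Xx z + Yy z) by contH.
have E : J (- r) r (fun x => source (x, y)) =
    - J (- r) r (fun x => Px (x, y) * phiy (x, y) - Py (x, y) * phix (x, y)) +
    J (- r) r (fun x => Xx (x, y) + Yy (x, y)).
  rewrite addrC -JB; [|exact: (contH_Ix cXY)|exact: (contH_Ix cS1)].
  apply: J_eq => x _; rewrite ePx// ePy//.
  have hd : vy (x, y) = - ux (x, y).
    by apply/eqP; rewrite -addr_eq0 addrC div0.
  rewrite /source /Xx /Yy /lap_eta /phi /phix /phiy /G /U /V hd /=.
  by ring.
rewrite E; apply: (is_derive_eq_on_pos y0 _ DW) => t t0.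
rewrite addrC -JB; [|exact: (contH_Ix cY)|exact: (contH_Ix cPphi)].
by apply: J_eq => x _; rewrite /flux /Y; ring.
Qed.

Lemma flux_top : J (- r) r (fun x => flux (x, r)) = 0.
Proof.
rewrite (@J_eq _ _ _ _ (fun=> 0)); first by rewrite J_cst ?mul0r.
move=> x _; rewrite /flux /phi /etay /eta /= chi_r// chi1_r//.
by rewrite !mulr0; ring.
Qed.

End Flux.
Hypotheses (cg : contH g) (g0 : forall z, half_plane z -> 0 <= g z).
Hypothesis goo : (\int[(@lebesgue_measure R) \x (@lebesgue_measure R)]_(z in
  @half_plane R) (g z)%:E < +oo)%E.
Hypotheses (wg : forall z, half_plane z -> w z ^+ 2 <= 2 * g z)
  (uxg : forall z, half_plane z -> ux z ^+ 2 <= g z)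
  (uyg : forall z, half_plane z -> uy z ^+ 2 <= g z)
  (vyg : forall z, half_plane z -> vy z ^+ 2 <= g z).
Hypotheses
  (bwy : forall r, exists M, forall x y, `|x| <= r -> 0 < y <= r -> `|wy (x, y)| <= M)
  (bv : forall r, exists M, forall x y, `|x| <= r -> 0 < y <= r -> `|v (x, y)| <= M).
Hypotheses
  (w0 : forall r e : R, 0 < e -> exists2 d0 : R, 0 < d0 &
     forall x y, `|x| <= r -> 0 < y < d0 -> `|w (x, y)| <= e)
  (v0 : forall r e : R, 0 < e -> exists2 d0 : R, 0 < d0 &
     forall x y, `|x| <= r -> 0 < y < d0 -> `|v (x, y)| <= e).

(** Once [Px] is replaced by its formula, each term contains [hh w], [HH w] or [w hh w - HH w], all
    at most [|w|], next to factors bounded up to the boundary. *)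
Lemma flux_bottom r e : 1 <= r -> 0 < e -> exists2 d0 : R, 0 < d0 &
  forall dl, 0 < dl < d0 -> dl <= r ->
    `|J (- r) r (fun x => flux r (x, dl))| <= e.
Proof.
move=> r1 e0; have r0 : 0 < r by exact: lt_le_trans r1.
have rr : - r <= r by lra.
have [M1 HM1] := bwy r; have [M2 HM2] := bv r.
(* One summand for each term of the flux: [wy], twice [v + b], and [|etay| <= 4]. *)
pose K := `|M1| + 2 * (`|M2| + `|b|) + 4.
have K0 : 0 < K by have := normr_ge0 M1; have := normr_ge0 M2; have := normr_ge0 b; rewrite /K; lra.
have Kr : 0 < K * (2 * r) by rewrite !mulr_gt0.
(* The cap 1 gives [|w hh w| <= s^2 <= s]; the factor [2 r] is the length of the edge. *)
pose s := Num.min 1 (e / (K * (2 * r))).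
have s0 : 0 < s by rewrite lt_min ltr01 divr_gt0.
have [d0 d00 Hd] := w0 r s0.
exists d0 => // dl /andP[dl0 dld] dlr.
have ylr : 0 < dl <= r by rewrite dl0.
have s1 : s <= 1 by rewrite ge_min lexx.
have se : K * s * (2 * r) <= e.
  rewrite mulrAC -ler_pdivlMl// mulrC /s ge_min; apply/orP; right.
  by rewrite mulrC.
apply: le_trans se; have r2 : r - - r = 2 * r by ring.
rewrite -r2; apply: J_abs_le => //.
  have rn0 : r != 0 by rewrite gt_eqF.
  have cf : contH (flux r).
    rewrite /flux; have ? := contH_eta rn0; have ? := contH_etay rn0.
    have ? : contH (fun z => HH (w z)) by apply: contH_comp => //; exact: HH_continuous.
    have ? : contH (fun z => hh (w z)) by apply: contH_comp => //; exact: hh_continuous.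
    by contH.
  exact: contH_Ix.
move=> x; rewrite -ler_norml => xr.
have hw : `|w (x, dl)| <= s by apply: Hd => //; rewrite dl0.
have h1 : `|wy (x, dl)| <= `|M1| by apply: le_trans (HM1 _ _ xr ylr) (ler_norm _).
have h2 : `|v (x, dl) + b| <= `|M2| + `|b|.
  apply: le_trans (ler_normD _ _) _; rewrite lerD2r.
  by apply: le_trans (HM2 _ _ xr ylr) (ler_norm _).
have /andP[e0' e1'] := eta_01 r0 xr ylr.
have hey : `|etay r (x, dl)| <= 4.
  apply: (le_trans (etay_le r0 xr ylr)).
  rewrite ler_pdivrMr ?exprn_gt0// ler_pM2l//; apply: (le_trans dlr).
  by rewrite expr2 ler_peMr// ltW.
have hh1 := le_trans (hh_le (w (x, dl))) hw.
have HH1 : `|HH (w (x, dl))| <= s.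
  by rewrite ger0_norm ?HH_ge0//; apply: le_trans (HH_le _) hw.
have G1 := le_trans (shh_HH_le (w (x, dl))) hw.
(* The term [- a v] of [Px] cancels against the correction. *)
have -> : flux r (x, dl) = wy (x, dl) * (hh (w (x, dl)) * eta r (x, dl))
   - (v (x, dl) + b) * (w (x, dl) * hh (w (x, dl)) * eta r (x, dl))
   + (v (x, dl) + b) * ((w (x, dl) * hh (w (x, dl)) - HH (w (x, dl))) * eta r (x, dl))
   - HH (w (x, dl)) * etay r (x, dl).
  by rewrite /flux ePx//; ring.
have T1 : `|wy (x, dl) * (hh (w (x, dl)) * eta r (x, dl))| <= `|M1| * s.
  rewrite normrM; apply: ler_pM => //; rewrite normrM (ger0_norm e0').
  by apply: le_trans hh1; rewrite ler_piMr.
have T2 : `|(v (x, dl) + b) * (w (x, dl) * hh (w (x, dl)) * eta r (x, dl))| <=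
    (`|M2| + `|b|) * s.
  rewrite normrM; apply: ler_pM => //; rewrite normrM (ger0_norm e0').
  apply: (@le_trans _ _ `|w (x, dl) * hh (w (x, dl))|); first by rewrite ler_piMr.
  rewrite normrM -[leRHS]mul1r; apply: ler_pM => //.
  exact: le_trans s1.
have T3 : `|(v (x, dl) + b) * ((w (x, dl) * hh (w (x, dl)) - HH (w (x, dl))) * eta r (x, dl))|
    <= (`|M2| + `|b|) * s.
  rewrite normrM; apply: ler_pM => //; rewrite normrM (ger0_norm e0').
  by apply: le_trans G1; rewrite ler_piMr.
have T4 : `|HH (w (x, dl)) * etay r (x, dl)| <= s * 4.
  by rewrite normrM; apply: ler_pM.
apply: (le_trans (ler_normB _ _)); have -> : K * s =
  `|M1| * s + (`|M2| + `|b|) * s + (`|M2| + `|b|) * s + s * 4 by rewrite /K; ring.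
apply: lerD => //; apply: (le_trans (ler_normD _ _)); apply: lerD => //.
by apply: (le_trans (ler_normB _ _)); apply: lerD.
Qed.

(** The parameters are fixed in the order [k], [r], [dl]. Each third of [e] pays for one error: the
    Hardy part, the weighted tail, the bottom flux. *)
Lemma vorticity_gradient_eq0 z : half_plane z -> wx z ^+ 2 + wy z ^+ 2 = 0.
Proof.
have ckkw : contH (fun z => kk (w z)) by apply: contH_comp => //; exact: kk_continuous.
pose q z := kk (w z) * (wx z ^+ 2 + wy z ^+ 2).
suff H : forall z, half_plane z -> q z = 0.
  by move=> /H /eqP; rewrite mulf_eq0 gt_eqF ?kk_gt0//= => /eqP.
have cq : contH q by rewrite /q; contH.
apply: eq0_of_cutoff_integrals => // {z}.
  move=> z _; apply: mulr_ge0; first by rewrite ltW ?kk_gt0.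
  by rewrite addr_ge0 ?sqr_ge0.
move=> e e0.
set D := fine (\int[(@lebesgue_measure R) \x (@lebesgue_measure R)]_(z in
  @half_plane R) (g z)%:E)%E.
have gD r dl : 0 < r -> 0 < dl -> boxint r dl g <= D by exact: boxint_dirichlet.
have [x0 [D0 [x01 HD0]]] := vertical_line_integral cg g0 goo.
have [c c0 Hc] := linear_growth_on_line du' cuy cg uyg HD0.
have D1 : 0 < 20 * `|D| + 4 by have := normr_ge0 D; lra.
have e3 : 0 < e / 3 by rewrite divr_gt0.
pose k := e / 3 / (20 * `|D| + 4).
have k0 : 0 < k by rewrite divr_gt0.
have kD : k * (20 * D + 4) <= e / 3.
  rewrite -[leRHS](divfK (lt0r_neq0 D1)) -/k ler_pM2l//.
  by have := ler_norm D; lra.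
pose C0 := 4 / k + 4 * (c + `|a|) + 2 * `|b| + 8.
have k4 : 0 <= 4 / k by rewrite divr_ge0// ltW.
have ca : 0 <= c + `|a| by rewrite addr_ge0.
have C00 : 0 <= C0.
  rewrite /C0; apply: addr_ge0 => //; apply: addr_ge0; last exact: mulr_ge0.
  by apply: addr_ge0 => //; exact: mulr_ge0.
(* The factor 2 comes from [w^2 <= 2 g]. *)
have C20 : 0 <= 2 * C0 by rewrite mulr_ge0.
have [r0 r01 Hr] := cutoff_error_bound du dv cu cux cv cvy cg g0 uxg vyg v0 goo x01 gD k0 C20 e3.
exists r0 => // r r0r; have r1 : 1 <= r by exact: le_trans r0r.
have rp : 0 < r by exact: lt_le_trans r1.
have rn0 : r != 0 by rewrite gt_eqF.
have [d1 d10 Hd1] := Hr r r0r.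
have [d2 d20 Hd2] := flux_bottom r1 e3.
exists (Num.min d1 d2); first by rewrite lt_min d10.
move=> dl /andP[dl0]; rewrite lt_min => /andP[dd1 dd2] dlr.
have /Hd1 -/(_ dlr) : 0 < dl < d1 by rewrite dl0.
have /Hd2 -/(_ (ltW dlr)) : 0 < dl < d2 by rewrite dl0.
have ce := contH_eta rn0; have cex := contH_etax rn0; have cey := contH_etay rn0.
have cwt := contH_wt (r := r); have cul := contH_line (x0 := x0) cu.
have cHH : contH (fun z => HH (w z)) by apply: contH_comp => //; exact: HH_continuous.
have cS := source_contH rp.
have EF : boxint r dl (source r) =
    J (- r) r (fun x => flux r (x, r)) - J (- r) r (fun x => flux r (x, dl)).
  by apply: boxint_flux => // [|y]; [exact: ltW|exact: flux_derive].
have -> : J (- r) r (fun x => flux r (x, dl)) = - boxint r dl (source r).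
  by rewrite EF flux_top// sub0r opprK.
rewrite normrN => hS hI.
have cL : contH (lap_eta r).
  rewrite /lap_eta; apply: contH_D; apply: contH_M.
  - by apply: contH_fst; exact: contH_chi2.
  - by apply: contH_snd; exact: contH_chi.
  - by apply: contH_fst; exact: contH_chi.
  - by apply: contH_snd; exact: contH_chi2.
pose rest z := HH (w z) * (lap_eta r z + (u z + a * z.2) * etax r z
  + (v z + b) * etay r z).
have cR : contH rest by rewrite /rest; contH.
have E : boxint r dl (fun z => q z * eta r z) = boxint r dl (source r) + boxint r dl rest.
  rewrite -(boxint_D rp dl0 cS cR); apply: boxint_eq => x y _ _.
  by rewrite /source /rest /q; ring.
rewrite E; have hS' := le_trans (ler_norm _) hS.
have hR : boxint r dl rest <= k * (20 * D + 4) + e / 3.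
  apply: le_trans hI; apply: boxint_le => //; first by contH.
  move=> x y xr /andP[ya yb]; have y0 : 0 < y by exact: lt_le_trans ya.
  have yr : 0 < y <= r by rewrite y0.
  have hA : `|u (x0, y) + a * y| <= (c + `|a|) * (1 + y).
    apply: (le_trans (ler_normD _ _)); rewrite mulrDl; apply: lerD; first exact: Hc.
    by rewrite normrM (gtr0_norm y0) ler_wpM2l// lerDr.
  have := drift_bound (u (x, y) - u (x0, y)) (v (x, y)) b r1 xr yr k0 ca
    (HH_ge0 (w (x, y))) (HH_le2 (w (x, y))) (HH_le (w (x, y)))
    (etax_le rp xr yr) (etay_le rp xr yr) (lap_eta_le rp xr yr) hA.
  rewrite -/C0 => hdb; rewrite /rest /=.
  (* The horizontal drift is split into the part controlled by Hardy's inequality and the part of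
     linear growth. *)
  have -> : u (x, y) + a * y = u (x, y) - u (x0, y) + (u (x0, y) + a * y) by ring.
  apply: (le_trans hdb); rewrite lerD2l.
  have -> : 2 * C0 * (g (x, y) * wt r (x, y)) = C0 * (2 * g (x, y) * wt r (x, y)) by ring.
  apply: ler_wpM2l => //; apply: ler_wpM2r; last exact: wg.
  rewrite divr_ge0 ?(ltW rp)//.
  by rewrite addr_ge0 ?addr_ge0// ltW.
have -> : e = e / 3 + (e / 3 + e / 3) by field.
apply: lerD => //; apply: (le_trans hR); by rewrite lerD2r.
Qed.

End Vorticity.

(** * Irrotational flows *)

Section Irrotational.
Variable R : realType.
Variables (u ux uy v vx vy : R * R -> R).
Hypotheses (dux : pdx u ux) (duy : pdy u uy) (dvx : pdx v vx) (dvy : pdy v vy).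
Hypotheses (cu : contH u) (cux : contH ux) (cuy : contH uy)
  (cv : contH v) (cvx : contH vx) (cvy : contH vy).
Hypotheses (div0 : forall z, half_plane z -> ux z + vy z = 0)
  (curl0 : forall z, half_plane z -> vx z - uy z = 0).
Let g z := ux z ^+ 2 + uy z ^+ 2 + vx z ^+ 2 + vy z ^+ 2.
Hypothesis goo : (\int[(@lebesgue_measure R) \x (@lebesgue_measure R)]_(z in
  @half_plane R) (g z)%:E < +oo)%E.
Hypotheses
  (bux : forall r, exists M, forall x y, `|x| <= r -> 0 < y <= r -> `|ux (x, y)| <= M)
  (v0 : forall r e : R, 0 < e -> exists2 d0 : R, 0 < d0 &
     forall x y, `|x| <= r -> 0 < y < d0 -> `|v (x, y)| <= e).

(** By the Cauchy-Riemann relations [vx = uy] and [vy = - ux], the weak curl of [grad u] tested with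
    [phi = v eta] has integrand [- (vx phix + vy phiy)]. Thus [is_derive_weak_flux] with [P = u]
    gives the weak form of [lap v = 0] from first derivatives alone. *)
Lemma irrotational_gradient_eq0 z : half_plane z -> vx z ^+ 2 + vy z ^+ 2 = 0.
Proof.
pose q z := vx z ^+ 2 + vy z ^+ 2.
have cq : contH q by rewrite /q; contH.
have cg : contH g by rewrite /g; contH.
have g0 z' : half_plane z' -> 0 <= g z' by move=> _; rewrite /g !addr_ge0 ?sqr_ge0.
have qg z' : q z' <= g z'.
  rewrite /q /g -[_ + vx z' ^+ 2 + _]addrA lerDr.
  by rewrite addr_ge0 ?sqr_ge0.
have uxg z' : half_plane z' -> ux z' ^+ 2 <= g z'.
  by move=> _; rewrite /g -!addrA lerDl !addr_ge0 ?sqr_ge0.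
have vyg z' : half_plane z' -> vy z' ^+ 2 <= g z'.
  by move=> _; rewrite /g lerDr !addr_ge0 ?sqr_ge0.
move: z; apply: eq0_of_cutoff_integrals => // [z _|e e0]; first by rewrite /q addr_ge0 ?sqr_ge0.
set D := fine (\int[(@lebesgue_measure R) \x (@lebesgue_measure R)]_(z in
  @half_plane R) (g z)%:E)%E.
have gD r dl : 0 < r -> 0 < dl -> boxint r dl g <= D by exact: boxint_dirichlet.
have D1 : 0 < 20 * `|D| + 4 by have := normr_ge0 D; lra.
have e3 : 0 < e / 3 by rewrite divr_gt0.
pose k := e / 3 / (20 * `|D| + 4).
have k0 : 0 < k by rewrite divr_gt0.
have kD : k * (20 * D + 4) <= e / 3.
  rewrite -[leRHS](divfK (lt0r_neq0 D1)) -/k ler_pM2l//.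
  by have := ler_norm D; lra.
have C0 : 0 <= 8 / k by rewrite divr_ge0// ltW.
have x01 : 0 <= (0 : R) <= 1 by rewrite lexx ler01.
have [r0 r01 Hr] := cutoff_error_bound dux dvy cu cux cv cvy cg g0 uxg vyg v0 goo x01 gD k0 C0 e3.
exists r0 => // r r0r; have r1 : 1 <= r by exact: le_trans r0r.
have rp : 0 < r by exact: lt_le_trans r1.
have rn0 : r != 0 by rewrite gt_eqF.
have rr : - r <= r by lra.
have [d1 d10 Hd1] := Hr r r0r.
have [M HM] := bux r.
(* Chosen so that the bottom flux, at most [|M| s] on an edge of length [2 r], stays below [e / 3];
   the [+ 1] covers [M = 0]. *)
pose s := e / 3 / ((`|M| + 1) * (2 * r)).
have M1 : 0 < (`|M| + 1) * (2 * r).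
  by apply: mulr_gt0; [exact: ltr_wpDl|exact: mulr_gt0].
have s0 : 0 < s by rewrite divr_gt0.
have [d2 d20 Hd2] := v0 r s0.
exists (Num.min d1 d2); first by rewrite lt_min d10.
move=> dl /andP[dl0]; rewrite lt_min => /andP[dd1 dd2] dlr.
have /Hd1 -/(_ dlr) hI : 0 < dl < d1 by rewrite dl0.
have ce := contH_eta rn0; have cex := contH_etax rn0; have cey := contH_etay rn0.
have cwt := contH_wt (r := r); have cul := contH_line (x0 := 0) cu.
pose phi z := v z * eta r z.
pose phix z := vx z * eta r z + v z * etax r z.
pose phiy z := vy z * eta r z + v z * etay r z.
have cphi : contH phi by rewrite /phi; contH.
have cphix : contH phix by rewrite /phix; contH.
have cphiy : contH phiy by rewrite /phiy; contH.
have dphix : pdx phi phix.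
  move=> x y y0; rewrite /phi /phix; have h1 := dvx x y0; have h2 := eta_pdx rn0 x y0.
  by notypeclasses refine (is_derive_cast _ _); [der|rewrite /=; ring].
have dphiy : pdy phi phiy.
  move=> x y y0; rewrite /phi /phiy; have h1 := dvy x y0; have h2 := eta_pdy rn0 x y0.
  by notypeclasses refine (is_derive_cast _ _); [der|rewrite /=; ring].
pose F z := ux z * phi z.
pose S z := ux z * phiy z - uy z * phix z.
have cF : contH F by rewrite /F; contH.
have cS : contH S by rewrite /S; contH.
have EF : boxint r dl S = J (- r) r (fun x => F (x, r)) - J (- r) r (fun x => F (x, dl)).
  apply: boxint_flux => // [|y y0]; first exact: ltW.
  apply: (is_derive_weak_flux rr y0 dux duy cux cuy dphix dphiy) => // t _.
    by rewrite /phi /eta /= chi_Nr// mul0r mulr0.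
  by rewrite /phi /eta /= chi_r// mul0r mulr0.
have F0 : J (- r) r (fun x => F (x, r)) = 0.
  rewrite (@J_eq _ _ _ _ (fun=> 0)); first by rewrite J_cst ?mul0r.
  by move=> x _; rewrite /F /phi /eta /= chi_r// !mulr0.
have ylr : 0 < dl <= r by rewrite dl0 ltW.
have Fs : J (- r) r (fun x => F (x, dl)) <= e / 3.
  apply: le_trans (ler_norm _) _.
  apply: (@le_trans _ _ (`|M| * s * (r - - r))).
    apply: J_abs_le => //; first exact: contH_Ix.
    move=> x; rewrite -ler_norml => xr; have /andP[e0' e1'] := eta_01 rp xr ylr.
    rewrite /F normrM; apply: ler_pM => //.
      by apply: le_trans (HM _ _ xr ylr) (ler_norm _).
    rewrite /phi normrM (ger0_norm e0'); apply: (@le_trans _ _ `|v (x, dl)|).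
      by rewrite ler_piMr.
    by apply: Hd2 => //; rewrite dl0.
  have -> : r - - r = 2 * r by ring.
  apply: (@le_trans _ _ ((`|M| + 1) * s * (2 * r))).
    apply: ler_wpM2r; first by rewrite mulr_ge0// ltW.
    by apply: ler_wpM2r; [exact: ltW|rewrite lerDl].
  by rewrite mulrAC /s mulrC divfK// gt_eqF.
pose rest z := - (v z * (vx z * etax r z + vy z * etay r z)).
have cR : contH rest by rewrite /rest; contH.
have cNS : contH (fun z => -1 * S z) by contH.
have E : boxint r dl (fun z => q z * eta r z) = - boxint r dl S + boxint r dl rest.
  rewrite -mulN1r -(boxint_Z (-1) rp dl0 cS) -(boxint_D rp dl0 cNS cR).
  apply: boxint_eq => x y _ /andP[ya _].
  have hz : half_plane (x, y) by exact: lt_le_trans ya.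
  have hv : vx (x, y) = uy (x, y) by apply/eqP; rewrite -subr_eq0 curl0.
  have hd : vy (x, y) = - ux (x, y).
    by apply/eqP; rewrite -addr_eq0 addrC div0.
  by rewrite /S /rest /q /phix /phiy hd hv; ring.
have hR : boxint r dl rest <= k * (20 * D + 4) + e / 3.
  apply: le_trans hI; apply: boxint_le => //; first by contH.
  move=> x y xr /andP[ya yb]; have y0 : 0 < y by exact: lt_le_trans ya.
  have yr : 0 < y <= r by rewrite y0.
  have hgb := gradient_bound (u (x, y) - u (0, y)) (v (x, y)) (vx (x, y)) (vy (x, y))
    r1 xr yr k0 (etax_le rp xr yr) (etay_le rp xr yr).
  rewrite /rest /=; apply: (le_trans hgb); rewrite lerD2l.
  apply: ler_wpM2l => //; apply: ler_wpM2r; last exact: qg.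
  rewrite divr_ge0 ?(ltW rp)//.
  by rewrite addr_ge0 ?addr_ge0// ltW.
have -> : e = e / 3 + (e / 3 + e / 3) by field.
rewrite E EF F0 sub0r opprK; apply: lerD => //.
by apply: (le_trans hR); rewrite lerD2r.
Qed.

End Irrotational.

(** * Conclusion *)

Section Constancy.
Variable R : realType.
Implicit Types f : R * R -> R.

Lemma vertical_constant f fy (x y1 y2 : R) : pdy f fy ->
  (forall z, half_plane z -> fy z = 0) -> 0 < y1 -> 0 < y2 ->
  f (x, y1) = f (x, y2).
Proof.
move=> df f0; wlog y12 : y1 y2 / y1 <= y2.
  by move=> H h1 h2; have [/H|/ltW/H] := leP y1 y2 => -> //.
move=> h1 h2; have cz : contI y1 y2 (fun=> 0 : R) by move=> y _; exact: cC.
have dF y : y1 <= y <= y2 -> is_derive y 1 (fun t => f (x, t)) (0 : R).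
  move=> /andP[hy _]; have y0 : 0 < y by exact: lt_le_trans hy.
  by rewrite -(f0 (x, y))//; exact: df.
have := J_FTC y12 cz dF; rewrite J_cst// mul0r => H.
by apply/eqP; rewrite eq_sym -subr_eq0 -H.
Qed.

Lemma horizontal_constant f fx (x1 x2 y : R) : pdx f fx ->
  (forall z, half_plane z -> fx z = 0) -> 0 < y -> f (x1, y) = f (x2, y).
Proof.
move=> df f0; wlog x12 : x1 x2 / x1 <= x2.
  by move=> H h1; have [/H|/ltW/H] := leP x1 x2 => -> //.
move=> y0; have cz : contI x1 x2 (fun=> 0 : R) by move=> x _; exact: cC.
have dF x : x1 <= x <= x2 -> is_derive x 1 (fun t => f (t, y)) (0 : R).
  by move=> _; rewrite -(f0 (x, y))//; exact: df.
have := J_FTC x12 cz dF; rewrite J_cst// mul0r => H.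
by apply/eqP; rewrite eq_sym -subr_eq0 -H.
Qed.

Lemma gradient0_constant f fx fy : pdx f fx -> pdy f fy ->
  (forall z, half_plane z -> fx z = 0) -> (forall z, half_plane z -> fy z = 0) ->
  constant_on_half_plane f.
Proof.
move=> dfx dfy fx0 fy0; exists (f (0, 1)) => -[x y] y0.
rewrite (vertical_constant x (y1 := y) (y2 := 1) dfy fy0)//.
exact: (horizontal_constant _ _ dfx fx0).
Qed.

Lemma pdx_unique f g fx gx z : pdx f fx -> pdx g gx ->
  (forall z, half_plane z -> f z = g z) -> half_plane z -> fx z = gx z.
Proof.
case: z => x y df dg fg y0; have h1 := df x y y0; have h2 := dg x y y0.
have E : (fun t => f (t, y)) = (fun t => g (t, y)) by apply/funext => t; exact: fg.
rewrite E in h1.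
by rewrite -(@derive_val _ _ _ _ _ _ _ h1) (@derive_val _ _ _ _ _ _ _ h2).
Qed.

Lemma pdy_unique f g fy gy z : pdy f fy -> pdy g gy ->
  (forall z, half_plane z -> f z = g z) -> half_plane z -> fy z = gy z.
Proof.
case: z => x y df dg fg y0; have h1 := df x y y0; have h2 := dg x y y0.
have h3 := is_derive_eq_on_pos y0 (fun t t0 => fg (x, t) t0) h1.
by rewrite -(@derive_val _ _ _ _ _ _ _ h3) (@derive_val _ _ _ _ _ _ _ h2).
Qed.

Lemma boundary_zero f : (forall x y1 y2, 0 < y1 -> 0 < y2 -> f (x, y1) = f (x, y2)) ->
  (forall r e : R, 0 < e -> exists2 d0 : R, 0 < d0 &
     forall x y, `|x| <= r -> 0 < y < d0 -> `|f (x, y)| <= e) ->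
  forall z, half_plane z -> f z = 0.
Proof.
move=> fc f0 [x y] y0; apply/eqP/negPn/negP => fn0.
have e0 : 0 < `|f (x, y)| / 2 by rewrite divr_gt0 ?normr_gt0.
have [d d0 Hd] := f0 `|x| _ e0.
have d2 : 0 < d / 2 < d by rewrite divr_gt0//= ltr_pdivrMr// ltr_pMr// ltr1n.
have := Hd x (d / 2) (lexx _) d2.
rewrite (fc x (d / 2) y)//; last by case/andP: d2.
by rewrite leNgt ltr_pdivrMr// ltr_pMr ?ltr1n// normr_gt0.
Qed.

End Constancy.

Lemma curl_sqr_le (R : realFieldType) (s1 s2 s3 s4 : R) :
  (s3 - s2) ^+ 2 <= 2 * (s1 ^+ 2 + s2 ^+ 2 + s3 ^+ 2 + s4 ^+ 2).
Proof.
have := sqr_ge0 (s3 + s2); have := sqr_ge0 s1; have := sqr_ge0 s4.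
by rewrite !expr2; lra.
Qed.

(** * From the momentum equations to constancy *)

Section Liouville.
Variables (R : realType) (a b : R).
Variables (u ux uy uxx uxy uyx uyy v vx vy vxx vxy vyx vyy p px py : R * R -> R).
Hypotheses (du : pdx u ux) (du' : pdy u uy) (dv : pdy v vy) (dv' : pdx v vx)
  (dp : pdx p px) (dp' : pdy p py).
Hypotheses (duxx : pdx ux uxx) (duxy : pdy ux uxy) (duyx : pdx uy uyx)
  (duyy : pdy uy uyy) (dvxx : pdx vx vxx) (dvxy : pdy vx vxy)
  (dvyx : pdx vy vyx) (dvyy : pdy vy vyy).
Hypotheses (eu : extends_continuously u) (eux : extends_continuously ux)
  (euy : extends_continuously uy) (euxy : extends_continuously uxy)
  (euyx : extends_continuously uyx) (euyy : extends_continuously uyy).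
Hypotheses (ev : extends_continuously v) (evx : extends_continuously vx)
  (evy : extends_continuously vy) (evxx : extends_continuously vxx)
  (evxy : extends_continuously vxy) (evyx : extends_continuously vyx).
Hypothesis ePDEx : forall z, half_plane z ->
  uxx z + uyy z - (u z * ux z + v z * uy z) - (a * z.2 * ux z + b * uy z)
  - a * v z = px z.
Hypothesis ePDEy : forall z, half_plane z ->
  vxx z + vyy z - (u z * vx z + v z * vy z) - (a * z.2 * vx z + b * vy z) = py z.
Hypothesis div0 : forall z, half_plane z -> ux z + vy z = 0.
Hypotheses (hbv : forall x : R, boundary_value v x 0)
  (hbu : forall x : R, boundary_value uy x 0).
Hypothesis hD : (\int[(@lebesgue_measure R) \x (@lebesgue_measure R)]_(z in
  @half_plane R) (ux z ^+ 2 + uy z ^+ 2 + vx z ^+ 2 + vy z ^+ 2)%:E < +oo)%E.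

Lemma liouville : [/\ constant_on_half_plane u, constant_on_half_plane v
    & constant_on_half_plane p].
Proof.
have cu := extends_contH eu; have cv := extends_contH ev.
have cux := extends_contH eux; have cuy := extends_contH euy.
have cvx := extends_contH evx; have cvy := extends_contH evy.
have cuxy := extends_contH euxy; have cuyx := extends_contH euyx.
have cuyy := extends_contH euyy; have cvxx := extends_contH evxx.
have cvxy := extends_contH evxy; have cvyx := extends_contH evyx.
have uxv z : half_plane z -> ux z = - vy z.
  by move=> /div0 /eqP; rewrite addr_eq0 => /eqP.
have vyu z : half_plane z -> vy z = - ux z by move=> /uxv ->; rewrite opprK.
have dNvyx : pdx (fun z => - vy z) (fun z => - vyx z).
  by move=> x y y0; apply: dN; exact: dvyx.
have dNuxy : pdy (fun z => - ux z) (fun z => - uxy z).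
  by move=> x y y0; apply: dN; exact: duxy.
(* Differentiating the divergence equation and exchanging derivatives turns the Laplacian of [u]
   into [- wy], and below that of [v] into [wx]. *)
have euxx' z (hz : half_plane z) : uxx z = - vxy z.
  rewrite (pdx_unique duxx dNvyx uxv hz); congr (- _).
  exact/esym/(mixed_partials dv' dv dvxy dvyx).
have evyy z (hz : half_plane z) : vyy z = - uyx z.
  rewrite (pdy_unique dvyy dNuxy vyu hz); congr (- _).
  exact: (mixed_partials du du' duxy duyx).
pose w z := vx z - uy z.
pose wx z := vxx z - uyx z.
pose wy z := vxy z - uyy z.
have cw : contH w by rewrite /w; contH.
have cwx : contH wx by rewrite /wx; contH.
have cwy : contH wy by rewrite /wy; contH.
have dwx : pdx w wx by move=> x y y0; apply: dB; [exact: dvxx|exact: duyx].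
have dwy : pdy w wy by move=> x y y0; apply: dB; [exact: dvxy|exact: duyy].
pose P z := p z + 2^-1 * ((u z + a * z.2) ^+ 2 + (v z + b) ^+ 2).
(* [Px] and [Py] are defined by the required formulas, so their continuity is clear although none is
   assumed for the derivatives of [p]; the momentum equations then show that they are the partial
   derivatives of [P]. *)
pose Px z := - wy z + (v z + b) * w z - a * v z.
pose Py z := wx z - (u z + a * z.2) * w z + a * (u z + a * z.2).
have cPx : contH Px by rewrite /Px; contH.
have cPy : contH Py by rewrite /Py; contH.
have ePx z (hz : half_plane z) :
    px z = Px z - (u z + a * z.2) * ux z - (v z + b) * vx z.
  rewrite -ePDEx// euxx'// /Px /wy /w.
  by ring.
have ePy z (hz : half_plane z) :
    py z = Py z - (u z + a * z.2) * (uy z + a) - (v z + b) * vy z.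
  rewrite -ePDEy// evyy// /Py /wx /w.
  by ring.
have dPx : pdx P Px.
  move=> x y y0; rewrite /P /=.
  have h1 := dp x y0; have h2 := du x y0; have h3 := dv' x y0.
  notypeclasses refine (is_derive_cast _ _); first by der.
  by rewrite ePx//=; field.
have dPy : pdy P Py.
  move=> x y y0; rewrite /P /=.
  have h1 := dp' x y0; have h2 := du' x y0; have h3 := dv x y0.
  notypeclasses refine (is_derive_cast _ _); first by der.
  by rewrite ePy//=; field.
pose g z := ux z ^+ 2 + uy z ^+ 2 + vx z ^+ 2 + vy z ^+ 2.
have cg : contH g by rewrite /g; contH.
have g0 z : half_plane z -> 0 <= g z by move=> _; rewrite /g !addr_ge0 ?sqr_ge0.
have wg z : half_plane z -> w z ^+ 2 <= 2 * g z.
  by move=> _; exact: curl_sqr_le.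
have uxg z : half_plane z -> ux z ^+ 2 <= g z.
  by move=> _; rewrite /g -!addrA lerDl !addr_ge0 ?sqr_ge0.
have uyg z : half_plane z -> uy z ^+ 2 <= g z.
  by move=> _; rewrite /g addrAC -addrA [_ + uy z ^+ 2]addrC
    -!addrA lerDl !addr_ge0 ?sqr_ge0.
have vyg z : half_plane z -> vy z ^+ 2 <= g z.
  by move=> _; rewrite /g lerDr !addr_ge0 ?sqr_ge0.
have bwy r : exists M, forall x y, `|x| <= r -> 0 < y <= r -> `|wy (x, y)| <= M.
  have [M1 H1] := extends_bounded r evxy; have [M2 H2] := extends_bounded r euyy.
  exists (M1 + M2) => x y xr yr; apply: (le_trans (ler_normB _ _)).
  by apply: lerD; [exact: H1|exact: H2].
have v0 r e := @boundary_uniform R v r e hbv.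
have w0 (r e : R) : 0 < e -> exists2 d0 : R, 0 < d0 &
    forall x y, `|x| <= r -> 0 < y < d0 -> `|w (x, y)| <= e.
  move=> e0; have e2 : 0 < e / 2 by rewrite divr_gt0.
  have [d1 d10 H1] := boundary_uniform r (boundary_value_dx dv' evx hbv) e2.
  have [d2 d20 H2] := boundary_uniform r hbu e2.
  exists (Num.min d1 d2); first by rewrite lt_min d10.
  move=> x y xr /andP[y0]; rewrite lt_min => /andP[y1 y2].
  have -> : e = e / 2 + e / 2 by field.
  by apply: (le_trans (ler_normB _ _)); apply: lerD; [apply: H1|apply: H2];
    rewrite ?y0.
have gw := vorticity_gradient_eq0 du du' dv dwx dwy dPx dPy cu cux cuy cv cvy cw cwx cwy
  cPx cPy div0 (fun z _ => erefl) (fun z _ => erefl) cg g0 hD wg uxg uyg vyg bwy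
  (fun r => extends_bounded r ev) w0 v0.
have sq0 (s t : R) : s ^+ 2 + t ^+ 2 = 0 -> s = 0 /\ t = 0.
  move=> /eqP; rewrite paddr_eq0 ?sqr_ge0// !sqrf_eq0 => /andP[/eqP -> /eqP ->].
  by [].
have wy0 z : half_plane z -> wy z = 0 by move=> /gw /sq0 [].
have wz z : half_plane z -> w z = 0.
  apply: boundary_zero w0 z => x y1 y2; exact: (vertical_constant _ dwy wy0).
have gv := irrotational_gradient_eq0 du du' dv' dv cu cux cuy cv cvx cvy div0 wz hD
  (fun r => extends_bounded r eux) v0.
have vx0 z : half_plane z -> vx z = 0 by move=> /gv /sq0 [].
have vy0 z : half_plane z -> vy z = 0 by move=> /gv /sq0 [].
have ux0 z : half_plane z -> ux z = 0 by move=> hz; rewrite uxv// vy0// oppr0.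
have uy0 z : half_plane z -> uy z = 0.
  by move=> hz; have := wz z hz; rewrite /w vx0// sub0r => /eqP; rewrite oppr_eq0 => /eqP.
have vz z : half_plane z -> v z = 0.
  apply: boundary_zero v0 z => x y1 y2; exact: (vertical_constant _ dv vy0).
have wx0 z : half_plane z -> wx z = 0 by move=> /gw /sq0 [].
split.
- exact: (gradient0_constant du du').
- exact: (gradient0_constant dv' dv).
apply: (gradient0_constant dp dp') => z hz.
- by rewrite ePx// /Px wy0// wz// vz// ux0// vx0//; ring.
(* The term [a (u + a y)] left in [Py] cancels against the [y]-derivative of [|W|^2 / 2]. *)
- by rewrite ePy// /Py wx0// wz// uy0// vy0//; ring.
Qed.

End Liouville.

Theorem theorem2 (R : realType) (a b : R) (u v p : R * R -> R)
    (hsol : is_solution a b u v p)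
    (hbv : forall x : R, boundary_value v x 0)
    (hbu : forall x : R, boundary_value (dy u) x 0)
    (hu : Ck_closed 2 u) (hv : Ck_closed 2 v)
    (hD : (dirichlet_integral u v < +oo)%E) :
  [/\ constant_on_half_plane u, constant_on_half_plane v
    & constant_on_half_plane p].
Proof.
case: hsol => hp hsol.
case: hu => eu hpu [eux hpux _ euxy] [euy hpuy euyx euyy].
case: hv => ev hpv [evx hpvx evxx evxy] [evy hpvy evyx _].
apply: (liouville (has_partials_pdx hpu) (has_partials_pdy hpu)
  (has_partials_pdy hpv) (has_partials_pdx hpv)
  (has_partials_pdx hp) (has_partials_pdy hp)
  (has_partials_pdx hpux) (has_partials_pdy hpux)
  (has_partials_pdx hpuy) (has_partials_pdy hpuy)
  (has_partials_pdx hpvx) (has_partials_pdy hpvx)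
  (has_partials_pdx hpvy) (has_partials_pdy hpvy)
  eu eux euy euxy euyx euyy ev evx evy evxx evxy evyx
  (a := a) (b := b) _ _ _ hbv hbu hD) => z hz.
- by have [] := hsol z hz.
- by have [] := hsol z hz.
- by have [] := hsol z hz.
Qed.
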